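(* Let $\Phi$ be a Markovian cocycle on a Polish space $\mathbb{X}$ over a filtered dynamical system $(\Omega,\mathcal{F},P,(\theta_t)_{t\in\mathbb{R}},(\mathcal{F}_s^t)_{s\le t})$, with Markovian semigroup $(P_t)_{t\ge0}$, and let $Y$ be an adapted random periodic path of $\Phi$ of period $\tau>0$. Let $\rho_s$ be the law of $Y(s,\cdot)$, $s\in\mathbb{R}$, which is a $\tau$-periodic measure of $(P_t)$, and let $\bar\rho=\frac1\tau\int_0^\tau\rho_s\,ds$. Assume the following condition: for any $s\in\mathbb{R}$ and any $\Gamma\in\mathcal{I}_s^\tau$, for $P$-almost all $\omega\in\Omega$, either $L_s^\omega\cap\Gamma=\emptyset$ or $L_s^\omega\subseteq\Gamma$. If the dynamical system $(\Omega,\mathcal{F},P,(\theta_\tau^n)_{n\ge0})$ is ergodic, then the $\tau$-periodic measure $\{\rho_s\}_{s\in\mathbb{R}}$ is PS-ergodic, and hence $\bar\rho$ is ergodic (with respect to $(P_t)_{t\ge0}$).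
   Context: Setting. $(\Omega,\mathcal{F},P)$ is a probability space; $\theta:\mathbb{R}\times\Omega\to\Omega$ is jointly measurable with $\theta_0=\mathrm{id}$, $\theta_t\circ\theta_s=\theta_{t+s}$, $\theta_tP=P$. $\Phi:\mathbb{R}^+\times\Omega\times\mathbb{X}\to\mathbb{X}$ is measurable and, almost surely, $\Phi(0,\omega)=\mathrm{id}$, $\Phi(t+s,\omega)=\Phi(t,\theta_s\omega)\circ\Phi(s,\omega)$ for $t,s\ge0$. The $\sigma$-algebras $\mathcal{F}_s^t\subset\mathcal{F}$ $(s\le t)$ satisfy $\theta_u^{-1}\mathcal{F}_s^t=\mathcal{F}_{s+u}^{t+u}$, and $\Phi(t,\cdot)$ is $\mathcal{F}_0^t$-measurable for $t\ge0$. $\Phi$ is Markovian: $\Phi(t,\cdot)x$ is a Markov process with transition probability $P_t(x,\Gamma)=P(\{\omega:\Phi(t,\omega)x\in\Gamma\})$, semigroup $(P_t\varphi)(x)=\int_{\mathbb{X}}P_t(x,dy)\varphi(y)$ on bounded Borel functions, and $P_t^*\rho(\Gamma)=\int_{\mathbb{X}}P_t(x,\Gamma)\rho(dx)$ on probability measures. Random periodic path of period $\tau$: a measurable $Y:\mathbb{R}\times\Omega\to\mathbb{X}$ such that for almost all $\omega$, $\Phi(t,\theta_s\omega)Y(s,\omega)=Y(t+s,\omega)$ and $Y(s+\tau,\omega)=Y(s,\theta_\tau\omega)$ for all $t\ge0,s\in\mathbb{R}$. Adapted: $Y(s,\cdot)$ is measurable with respect to $\mathcal{F}_{-\infty}^s=\bigvee_{r\le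 s}\mathcal{F}_r^s$ for each $s$. The laws $\rho_s(\Gamma)=P(\{\omega:Y(s,\omega)\in\Gamma\})$ form a periodic measure of $(P_t)$ (known result, part of the setting): $P_t^*\rho_s=\rho_{s+t}$ and $\rho_{s+\tau}=\rho_s$ for all $s\in\mathbb{R},t\ge0$. Consequently each $\rho_s$ is invariant for $(P_{k\tau})_{k\in\mathbb{N}}$, and $\bar\rho$ is invariant for $(P_t)_{t\ge0}$. Notation. $L_s^\omega=\{Y(s+k\tau,\omega):k\in\mathbb{Z}\}$; $\mathcal{I}_s^\tau=\{\Gamma\in\mathcal{B}(\mathbb{X}):P_\tau I_\Gamma=I_\Gamma,\ \rho_s\text{-a.s.}\}$. Ergodicity. A measure preserving dynamical system is ergodic if every invariant measurable set has measure $0$ or $1$. An invariant measure $\rho$ of $(P_t)_{t\ge0}$ is ergodic if its canonical dynamical system $(\mathbb{X}^{\mathbb{R}},\mathcal{F}^*,(\theta^*_t)_{t\ge0},\mathbb{P}^\rho)$ is ergodic, where $\mathcal{F}^*$ is the $\sigma$-algebra generated by cylinder sets, $(\theta_t^*\omega^* )(s)=\omega^*(t+s)$, and $\mathbb{P}^\rho$ is the unique probability with finite-dimensional distributions $\rho(dx_1)P_{t_2-t_1}(x_1,dx_2)\cdots P_{t_n-t_{n-1}}(x_{n-1},dx_n)$ at times $t_1<\cdots<t_n$. Ergodicity of an invariant measure of the discrete semigroup $(P_{k\tau})_{k\in\mathbb{N}}$ is defined in the same way with discrete time; equivalently, $\Gamma\in\mathcal{B}(\mathbb{X})$ and $P_\tau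 I_\Gamma=I_\Gamma$ $\rho$-a.s. imply $\rho(\Gamma)\in\{0,1\}$. The $\tau$-periodic measure $\{\rho_s\}$ is PS-ergodic if for each $s\in[0,\tau)$, $\rho_s$ is ergodic as an invariant measure of $(P_{k\tau})_{k\in\mathbb{N}}$. *)

(* Defs.v *)
From HB Require Import structures.
From mathcomp Require Import all_boot all_order all_algebra.
From mathcomp Require Import all_classical all_reals all_analysis.

Set Implicit Arguments.
Unset Strict Implicit.
Unset Printing Implicit Defensive.

Import Order.TTheory GRing.Theory Num.Theory.
Import numFieldNormedType.Exports.

Local Open Scope classical_set_scope.
Local Open Scope ring_scope.
Local Open Scope ereal_scope.

Definition is_metric (R : realType) (X : Type) (dist : X -> X -> R) : Prop :=
  [/\ forall x y, (0 <= dist x y)%R,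
      forall x y, dist x y = 0%R <-> x = y,
      forall x y, dist x y = dist y x &
      forall x y z, (dist x z <= dist x y + dist y z)%R].

Definition metrizes (R : realType) (X : topologicalType) (dist : X -> X -> R)
    : Prop :=
  forall (x : X) (A : set X),
    nbhs x A <-> exists2 e : R, (0 < e)%R & [set y | (dist x y < e)%R] `<=` A.

Definition metric_complete (R : realType) (X : topologicalType)
    (dist : X -> X -> R) : Prop :=
  forall u : nat -> X,
    (forall e : R, (0 < e)%R -> exists N : nat, forall m n : nat,
       (N <= m)%N -> (N <= n)%N -> (dist (u m) (u n) < e)%R) ->
    exists l : X, u @ \oo --> l.

Definition polish_space (R : realType) (X : topologicalType) : Prop :=
  (exists2 D : set X, countable D & dense D) /\
  (exists dist : X -> X -> R,
     [/\ is_metric dist, metrizes dist & metric_complete dist]).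

Notation borel X := (g_sigma_algebraType (@open X)).

Section dynamics.
Context d (Omega : measurableType d) (R : realType) (P : probability Omega R).

Record metric_flow (theta : R -> Omega -> Omega) : Prop := MetricFlow {
  flow_measurable : measurable_fun [set: R * Omega]
    (fun p : R * Omega => theta p.1 p.2) ;
  flow0 : forall w, theta 0%R w = w ;
  flowD : forall t s w, theta (t + s)%R w = theta t (theta s w) ;
  flow_preserving : forall t (A : set Omega), measurable A ->
    P (theta t @^-1` A) = P A }.

Record filtration (theta : R -> Omega -> Omega) (F : R -> R -> set (set Omega))
    : Prop := Filtration {
  filtration_sigma : forall s t, (s <= t)%R -> sigma_algebra setT (F s t) ;
  filtration_sub : forall s t, (s <= t)%R -> F s t `<=` measurable ;
  filtration_shift : forall s t u, (s <= t)%R ->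
    preimage_set_system setT (theta u) (F s t) = F (s + u)%R (t + u)%R }.

Definition past_sigma (F : R -> R -> set (set Omega)) (s : R)
    : set (set Omega) :=
  <<s \bigcup_(r in [set r : R | (r <= s)%R]) F r s >>.

(* Almost sure invariance, rather than S^-1 A = A: for continuous time on a
   product space R -> X with its cylinder sigma-algebra, a measurable set
   depends on countably many coordinates, so that only the empty set and the
   whole space are strictly invariant under all shifts. *)
Definition ergodic_system (I : Type) (D : set I) (S : I -> Omega -> Omega)
    : Prop :=
  forall A : set Omega, measurable A ->
    (forall i, D i -> P (A `+` (S i @^-1` A)) = 0) -> P A = 0 \/ P A = 1.

End dynamics.

Section semigroups.
Context d (X : measurableType d) (R : realType).

Definition semigroup_op (T : Type) (Pt : T -> R.-pker X ~> X) (t : T)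
    (phi : X -> R) (x : X) : \bar R :=
  \int[Pt t x]_y (phi y)%:E.

Definition semigroup_dual (T : Type) (Pt : T -> R.-pker X ~> X) (t : T)
    (rho : probability X R) (G : set X) : \bar R :=
  \int[rho]_x Pt t x G.

Definition invariant_measure (T : numDomainType) (Pt : T -> R.-pker X ~> X)
    (rho : probability X R) : Prop :=
  forall t, (0 <= t)%R -> forall G, measurable G ->
    semigroup_dual Pt t rho G = rho G.

Definition periodic_measure (Pt : R -> R.-pker X ~> X) (tau : R)
    (rho : R -> probability X R) : Prop :=
  forall s G, measurable G ->
    (forall t, (0 <= t)%R -> semigroup_dual Pt t (rho s) G = rho (s + t)%R G) /\
    rho (s + tau)%R G = rho s G.

Definition invariant_sets (Pt : R -> R.-pker X ~> X) (tau : R)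
    (rho : probability X R) : set (set X) :=
  [set G | measurable G /\
    {ae rho, forall x, semigroup_op Pt tau \1_G x = (\1_G x)%:E}].

End semigroups.

Section canonical_system.
Context d (X : measurableType d) (R : realType) (T : numDomainType).

Definition cylinder (ts : seq T) (A : T -> set X) : set (T -> X) :=
  [set w | forall t, t \in ts -> A t (w t)].

Definition cylinders : set (set (T -> X)) :=
  [set C | exists (ts : seq T) (A : T -> set X),
     (forall t, measurable (A t)) /\ C = cylinder ts A].

Definition path_space := g_sigma_algebraType cylinders.

Definition path_shift (t : T) (w : path_space) : path_space :=
  fun s => w (t + s)%R.

(* \int_(A t_2) P_(t_2 - t) (x, dx_2) ... \int_(A t_n) P_(t_n - t_(n-1))
   (x_(n-1), dx_n) for ts = [:: t_2; ...; t_n]. *)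
Fixpoint fdd_from (Pt : T -> R.-pker X ~> X) (A : T -> set X) (t : T) (x : X)
    (ts : seq T) : \bar R :=
  if ts is t' :: ts' then
    \int[Pt (t' - t)%R x]_(y in A t') fdd_from Pt A t' y ts'
  else 1.

Definition fdd (Pt : T -> R.-pker X ~> X) (rho : probability X R)
    (A : T -> set X) (ts : seq T) : \bar R :=
  if ts is t :: ts' then \int[rho]_(x in A t) fdd_from Pt A t x ts' else 1.

Definition canonical_law (Pt : T -> R.-pker X ~> X) (rho : probability X R)
    (Q : probability path_space R) : Prop :=
  forall (ts : seq T) (A : T -> set X), sorted <%R ts ->
    (forall t, measurable (A t)) -> Q (cylinder ts A) = fdd Pt rho A ts.

(* For an invariant rho and a Markov semigroup on a Polish space, Kolmogorov's
   extension theorem provides exactly one Q with canonical_law Pt rho Q. *)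
Definition ergodic_measure (Pt : T -> R.-pker X ~> X) (rho : probability X R)
    : Prop :=
  invariant_measure Pt rho /\
  forall Q : probability path_space R, canonical_law Pt rho Q ->
    ergodic_system Q [set t : T | (0 <= t)%R] path_shift.

End canonical_system.

(* The semigroup (P_(k tau))_k, indexed by int since the canonical system in
   discrete time lives on int -> X; only indices k >= 0 matter. *)
Definition discrete_semigroup d (X : measurableType d) (R : realType)
    (Pt : R -> R.-pker X ~> X) (tau : R) : int -> R.-pker X ~> X :=
  fun k => Pt (k%:~R * tau)%R.

Definition PS_ergodic d (X : measurableType d) (R : realType)
    (Pt : R -> R.-pker X ~> X) (tau : R) (rho : R -> probability X R) : Prop :=
  forall s : R, (0 <= s < tau)%R ->
    ergodic_measure (discrete_semigroup Pt tau) (rho s).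

Section cocycles.
Context d d' (Omega : measurableType d) (X : measurableType d') (R : realType)
  (P : probability Omega R).

Definition natural_sigma (Z : R -> Omega -> X) (s : R) : set (set Omega) :=
  <<s \bigcup_(r in `[0%R, s]) preimage_set_system setT (Z r) measurable >>.

Definition markov_process (Pt : R -> R.-pker X ~> X) (Z : R -> Omega -> X)
    : Prop :=
  forall s t, (0 <= s)%R -> (0 <= t)%R ->
  forall (A : set Omega) (G : set X), natural_sigma Z s A -> measurable G ->
    P (A `&` (Z (s + t)%R @^-1` G)) = \int[P]_(w in A) Pt t (Z s w) G.

Record cocycle (theta : R -> Omega -> Omega) (F : R -> R -> set (set Omega))
    (Phi : R -> Omega -> X -> X) : Prop := Cocycle {
  cocycle_measurable :
    measurable_fun [set p : R * Omega * X | (0 <= p.1.1)%R]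
      (fun p : R * Omega * X => Phi p.1.1 p.1.2 p.2) ;
  cocycle_eq : {ae P, forall w,
    (forall x, Phi 0%R w x = x) /\
    (forall t s, (0 <= t)%R -> (0 <= s)%R -> forall x,
       Phi (t + s)%R w x = Phi t (theta s w) (Phi s w x))} ;
  cocycle_adapted : forall t, (0 <= t)%R -> forall x (G : set X),
    measurable G -> F 0%R t [set w | G (Phi t w x)] }.

Record markovian (Phi : R -> Omega -> X -> X) (Pt : R -> R.-pker X ~> X)
    : Prop := Markovian {
  markovian_transition : forall t, (0 <= t)%R -> forall x (G : set X),
    measurable G -> Pt t x G = P [set w | G (Phi t w x)] ;
  markovian_process : forall x, markov_process Pt (fun t w => Phi t w x) }.

Record random_periodic_path (theta : R -> Omega -> Omega)
    (Phi : R -> Omega -> X -> X) (tau : R) (Y : R -> Omega -> X) : Prop :=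
    RandomPeriodicPath {
  rpp_measurable :
    measurable_fun [set: R * Omega] (fun p : R * Omega => Y p.1 p.2) ;
  rpp_eq : {ae P, forall w,
    (forall t s, (0 <= t)%R ->
       Phi t (theta s w) (Y s w) = Y (t + s)%R w) /\
    (forall s, Y (s + tau)%R w = Y s (theta tau w))} }.

Definition adapted (F : R -> R -> set (set Omega)) (Y : R -> Omega -> X)
    : Prop :=
  forall s (G : set X), measurable G -> past_sigma F s (Y s @^-1` G).

Definition lattice_path (Y : R -> Omega -> X) (tau s : R) (w : Omega)
    : set X :=
  [set Y (s + k%:~R * tau)%R w | k in [set: int]].

Definition laws_of (Y : R -> Omega -> X) (rho : R -> probability X R) : Prop :=
  forall s (G : set X), measurable G -> rho s G = P (Y s @^-1` G).

Definition period_average (tau : R) (rho : R -> probability X R)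
    (rhobar : probability X R) : Prop :=
  forall G : set X, measurable G ->
    rhobar G = (tau^-1)%:E * \int[lebesgue_measure]_(s in `[0%R, tau]) rho s G.

End cocycles.

(* Main.v *)
(** Let [Q] be the canonical law of [(Pt, rho)] and [A] an almost surely
    shift-invariant event. Up to a small error in [L^1(Q)], [\1_A] is a linear
    combination of indicators of cylinders, and by invariance and stationarity
    this combination may be shifted as far into the past or into the future as
    we like. The Markov property at time 0 turns the conditional expectation of
    the future combination given the past into a function of [w 0], and
    conditioning is an [L^1]-contraction; hence [A] is almost surely of the
    form [{w | w 0 \in G}]. Comparing times 0 and [t] gives [P_t 1_G = 1_G]
    [rho]-almost everywhere, so that [rho] is ergodic as soon as such sets [G]
    have measure 0 or 1.

    For [rho_s] and [P_tau] the lattice condition makes the event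
    [Y s w \in G] almost surely invariant under [theta tau], and ergodicity of
    [theta tau] applies. For the average measure, [f s = rho_s G] is, for almost
    every [s], equal to 0 or 1 and invariant under each translation, so that
    [(\int f)^2 = tau * \int f] over a period. *)
Require Import Defs.
From mathcomp Require Import all_boot all_order all_algebra.
From mathcomp Require Import all_classical all_reals all_analysis.
From mathcomp Require Import measurable_realfun lra.
Import Order.TTheory GRing.Theory Num.Theory.
Import numFieldNormedType.Exports.
Local Open Scope classical_set_scope.
Local Open Scope ring_scope.

(** * Integration against mixtures of measures *)

Section mixture.
Set Implicit Arguments.
Unset Strict Implicit.
Local Open Scope ereal_scope.
Import HBNNSimple.
Context {d1 d2} {Z : measurableType d1} {X : measurableType d2} {R : realType}.

(** Simple functions approximate [f] from below, and monotone convergence is applied under each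
    [K z] and then under [mu]. What matters is that the right-hand side sees [K] only through the
    set function [U |-> \int[mu]_(z in D) K z U]. *)
Lemma ge0_integral_mixture_lim (mu : {measure set Z -> \bar R}) (D : set Z)
    (K : Z -> {measure set X -> \bar R}) (f : X -> \bar R)
    (mf : measurable_fun [set: X] f) :
  measurable D ->
  (forall U, measurable U -> measurable_fun [set: Z] (K ^~ U)) ->
  (forall x, 0 <= f x) ->
  let f_ := nnsfun_approx measurableT mf in
  \int[mu]_(z in D) \int[K z]_x f x =
  limn (fun n => \sum_(r \in range (f_ n))
    (r%:E * \int[mu]_(z in D) K z (f_ n @^-1` [set r]))).
Proof.
move=> mD mK f0 f_.
have mKn n : measurable_fun [set: Z] (fun z => \int[K z]_x (f_ n x)%:E).
  apply: measurable_fun_integral_kernel => //.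
  - by move=> x; rewrite lee_fin.
  - exact/measurable_EFinP.
transitivity (\int[mu]_(z in D) limn (fun n => \int[K z]_x (f_ n x)%:E)).
  apply: eq_integral => z _; rewrite -monotone_convergence//.
  - by apply: eq_integral => x _; apply/esym/cvg_lim => //; exact: cvg_nnsfun_approx.
  - by move=> n; exact/measurable_EFinP.
  - by move=> n x _; rewrite lee_fin.
  - by move=> x _ a b ab; rewrite lee_fin; exact/lefP/nd_nnsfun_approx.
rewrite monotone_convergence//; last 3 first.
- by move=> n; exact: measurable_funTS.
- by move=> n z _; apply: integral_ge0 => x _; rewrite lee_fin.
- move=> z _ a b ab; apply: ge0_le_integral => //.
  + by move=> x _; rewrite lee_fin.
  + exact/measurable_EFinP.
  + exact/measurable_EFinP.
  + by move=> x _; rewrite lee_fin; exact/lefP/nd_nnsfun_approx.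
apply: congr_lim; apply/funext => n.
under eq_integral do rewrite integralT_nnsfun sintegralE.
rewrite ge0_integral_fsum//; last 2 first.
- by move=> r; apply: measurable_funeM; exact/measurable_funTS/mK.
- by move=> r z _; exact: nnsfun_mulemu_ge0.
apply: eq_fsbigr => r _.
have [r0|r0] := leP 0%R r.
  by rewrite ge0_integralZl//; exact/measurable_funTS/mK.
rewrite preimage_nnfun0//.
under eq_integral do rewrite measure0 mule0.
by rewrite [in RHS]integral0_eq ?mule0 ?integral0.
Qed.

(** Serves twice: to replace a transition kernel by the Dirac mass at the next coordinate, and to
    compare the family [rho] with the constant family [rhobar]. *)
Lemma ge0_integral_mixture_eq (mu : {measure set Z -> \bar R}) (D : set Z)
    (K1 K2 : Z -> {measure set X -> \bar R}) (f : X -> \bar R) :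
  measurable D ->
  (forall U, measurable U -> measurable_fun [set: Z] (K1 ^~ U)) ->
  (forall U, measurable U -> measurable_fun [set: Z] (K2 ^~ U)) ->
  (forall U, measurable U ->
    \int[mu]_(z in D) K1 z U = \int[mu]_(z in D) K2 z U) ->
  measurable_fun [set: X] f -> (forall x, 0 <= f x) ->
  \int[mu]_(z in D) \int[K1 z]_x f x = \int[mu]_(z in D) \int[K2 z]_x f x.
Proof.
move=> mD mK1 mK2 K12 mf f0; rewrite !ge0_integral_mixture_lim//.
apply: congr_lim; apply/funext => n; apply: eq_fsbigr => r _.
by rewrite K12.
Qed.

End mixture.

(** * Cylinders and the Markov property of the canonical law *)

Section markov_property.
Set Implicit Arguments.
Unset Strict Implicit.
Local Open Scope ereal_scope.
Context {d} {X : measurableType d} {R : realType} {T : realDomainType}.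
Implicit Types (Pt : T -> R.-pker X ~> X) (rho : probability X R).
Implicit Types (A B : T -> set X) (ts us : seq T).

Lemma measurable_cylinder ts A : (forall t, measurable (A t)) ->
  measurable (cylinder ts A : set (path_space X T)).
Proof. by move=> mA; apply: sub_sigma_algebra; exists ts, A. Qed.

Lemma measurable_coord (t : T) :
  measurable_fun [set: path_space X T] (fun w : path_space X T => w t).
Proof.
move=> _ U mU; rewrite setTI.
suff -> : (fun w : path_space X T => w t) @^-1` U = cylinder [:: t] (fun=> U).
  exact: measurable_cylinder.
apply/seteqP; split=> w /=.
  by move=> Uw s; rewrite inE => /eqP ->.
by apply; rewrite inE.
Qed.

Lemma measurable_preimage_coord (t : T) (G : set X) : measurable G ->
  measurable ((fun w : path_space X T => w t) @^-1` G).
Proof. by move=> mG; rewrite -[X in measurable X]setTI; exact: measurable_coord. Qed.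

Lemma eq_cylinder ts A B : {in ts, A =1 B} -> cylinder ts A = cylinder ts B.
Proof. by move=> AB; apply/seteqP; split=> w wA t tts; [rewrite -AB//|rewrite AB//];
exact: wA. Qed.

Lemma eq_mem_cylinder ts us A : ts =i us -> cylinder ts A = cylinder us A.
Proof.
move=> tsus; apply/seteqP; split=> w wA t tin; apply: wA.
  by rewrite tsus.
by rewrite -tsus.
Qed.

Lemma cylinder_cat ts us A :
  cylinder (ts ++ us) A = cylinder ts A `&` cylinder us A.
Proof.
apply/seteqP; split=> w.
  by move=> wA; split=> t tin; apply: wA; rewrite mem_cat tin ?orbT.
by move=> [wt wu] t; rewrite mem_cat => /orP[]; [exact: wt|exact: wu].
Qed.

Lemma cylinder1 (t : T) A : cylinder [:: t] A = (fun w : T -> X => w t) @^-1` A t.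
Proof.
apply/seteqP; split=> w /=; first by apply; rewrite inE.
by move=> Uw s; rewrite inE => /eqP ->.
Qed.

Lemma eq_fdd_from Pt A B ts t x : {in ts, A =1 B} ->
  fdd_from Pt A t x ts = fdd_from Pt B t x ts.
Proof.
elim: ts t x => //= s ts IH t x AB.
rewrite -AB ?mem_head//; apply: eq_integral => y _.
by apply: IH => u uts; apply: AB; rewrite inE uts orbT.
Qed.

Lemma fdd_from_ge0 Pt A ts t x : 0 <= fdd_from Pt A t x ts.
Proof. by elim: ts t x => [//|s ts IH] t x /=; exact: integral_ge0. Qed.

Lemma measurable_fdd_from Pt A ts t : (forall s, measurable (A s)) ->
  measurable_fun [set: X] (fun x => fdd_from Pt A t x ts).
Proof.
move=> mA; elim: ts t => [t|s ts IH t] /=; first exact: measurable_cst.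
under eq_fun do rewrite integral_mkcond.
apply: measurable_fun_integral_kernel.
- by move=> U mU; exact: measurable_kernel.
- by move=> y; apply: erestrict_ge0 => z _; exact: fdd_from_ge0.
- by apply/(measurable_restrictT _ _).1 => //; exact: measurable_funTS.
Qed.

Variables (Pt : T -> R.-pker X ~> X) (rho : probability X R).
Variable Q : probability (path_space X T) R.
Hypothesis HQ : canonical_law Pt rho Q.

Lemma canonical_coord0 (t : T) (G : set X) : measurable G ->
  Q ((fun w : T -> X => w t) @^-1` G) = rho G.
Proof.
move=> mG; rewrite -(cylinder1 t (fun=> G)) HQ//=.
by rewrite integral_cst// mul1e.
Qed.

(** Induction on the past, from its right end. With the last earlier time [r] as conditioning time
    and [s :: us] as future, the induction hypothesis gives an integral against [Pt (s - r) (w r)];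
    with [[:: s]] as future it says that this kernel is the conditional law of [w s], so that it may
    be replaced by the Dirac mass at [w s]. *)
Lemma canonical_markov_cylinder A ts s us : (forall t, measurable (A t)) ->
  sorted <%R (rcons ts s ++ us) ->
  Q (cylinder (rcons ts s ++ us) A) =
  \int[Q]_(w in cylinder (rcons ts s) A) fdd_from Pt A s (w s) us.
Proof.
elim/last_ind: ts A s us => [|ts r IH] A s us mA sorted_ts.
  rewrite HQ//= cylinder1.
  pose ev (w : path_space X T) := w s.
  transitivity (\int[pushforward Q ev]_(x in A s) fdd_from Pt A s x us).
    apply: eq_measure_integral; first exact: measurable_coord.
    move=> ? G mG _.
    exact/esym/(canonical_coord0 s mG).
  rewrite (ge0_integral_pushforward (measurable_coord s))//.
  - exact/measurable_funTS/measurable_fdd_from.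
  - by move=> y _; exact: fdd_from_ge0.
rewrite cat_rcons IH -?cat_rcons//.
have mB0 : measurable (cylinder (rcons ts r) A : set (path_space X T)).
  exact: measurable_cylinder.
set F := fun y => fdd_from Pt A s y us.
have mF : measurable_fun setT (F \_ (A s)).
  by apply/(measurable_restrictT _ _).1 => //; exact/measurable_funTS/measurable_fdd_from.
have F0 y : 0 <= (F \_ (A s)) y.
  by apply: erestrict_ge0 => z _; exact: fdd_from_ge0.
have uniq_ts : s \notin rcons ts r.
  have := lt_sorted_uniq sorted_ts.
  by rewrite cat_uniq rcons_uniq => /andP[/andP[]].
transitivity (\int[Q]_(w in cylinder (rcons ts r) A)
    \int[Pt (s - r)%R (w r)]_y (F \_ (A s)) y).
  by apply: eq_integral => w _ /=; rewrite integral_mkcond.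
transitivity (\int[Q]_(w in cylinder (rcons ts r) A)
    \int[\d_(w s)]_y (F \_ (A s)) y).
  apply: ge0_integral_mixture_eq => //.
  - move=> U mU; apply: (measurableT_comp (f := fun x => Pt (s - r)%R x U));
      last exact: measurable_coord.
    exact: measurable_kernel.
  - move=> U mU; apply/measurable_EFinP.
    apply: (measurableT_comp (f := \1_U : X -> R));
      last exact: measurable_coord.
    exact: measurable_indic.
  - move=> G mG.
    (* [A'] puts an arbitrary [G] at time [s] and leaves the conditioning cylinder alone, because
       [s] is not among the earlier times. *)
    pose A' t := if t == s then G else A t.
    have mA' t : measurable (A' t) by rewrite /A'; case: ifP.
    have A'A : {in rcons ts r, A' =1 A}.
      by move=> t tts; rewrite /A'; case: eqP => // ts'; rewrite -ts' tts in uniq_ts.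
    have sts : sorted <%R (rcons ts r ++ [:: s]).
      by move: sorted_ts; rewrite -cats1 => /cat_sorted2[].
    have := IH A' r [:: s] mA' sts.
    rewrite (eq_cylinder A'A) => IHs.
    rewrite [RHS](_ : _ = Q (cylinder (rcons ts r ++ [:: s]) A')).
      rewrite IHs; apply: eq_integral => w _ /=.
      by rewrite /A' eqxx integral_cst// mul1e.
    rewrite cylinder_cat (eq_cylinder A'A) cylinder1 /A' eqxx setIC.
    by rewrite -(integral_indic _ mB0 (measurable_preimage_coord s mG)).
under eq_integral do rewrite integral_dirac// diracT mul1e.
rewrite -(cats1 (rcons ts r)) cylinder_cat cylinder1 integral_mkcondr.
by apply: eq_integral => w _; rewrite /restrict /=; congr (if _ then _ else _).
Qed.

End markov_property.

(** * Extending equality of integrals from a pi-system *)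

Section pi_system_integral.
Set Implicit Arguments.
Unset Strict Implicit.
Local Open Scope ereal_scope.
Context {d} {T : measurableType d} {R : realType}.
Variable mu : {measure set T -> \bar R}.

(** Dynkin's argument: agreement passes to complements by subtraction from the integral over the
    whole space, which is finite by integrability, and to disjoint countable unions by additivity.
    It turns an identity tested on past cylinders into a conditional expectation given the past. *)
Lemma eq_integral_g_sigma (G : set (set T)) (f h : T -> \bar R) :
  G `<=` measurable -> setI_closed G -> G setT ->
  mu.-integrable setT f -> mu.-integrable setT h ->
  (forall B, G B -> \int[mu]_(x in B) f x = \int[mu]_(x in B) h x) ->
  forall B, <<s G >> B -> \int[mu]_(x in B) f x = \int[mu]_(x in B) h x.
Proof.
move=> Gm GI GT intf inth fh.
have sGm : <<s G >> `<=` measurable.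
  by apply: smallest_sub Gm; exact: sigma_algebra_measurable.
apply: (@dynkin_induction _ (g_sigma_algebraType G) G) => //.
- exact: fh.
- move=> S mS fhS.
  have {}mS : d.-measurable (S : set T) by exact: sGm mS.
  have splitS k : mu.-integrable setT k ->
      \int[mu]_(x in ~` S) k x = \int[mu]_x k x - \int[mu]_(x in S) k x.
    move=> intk.
    have fin D : measurable D -> \int[mu]_(x in D) k x \is a fin_num.
      by move=> mD; apply: integrable_fin_num => //; exact: integrableS intk.
    have -> : \int[mu]_x k x = \int[mu]_(x in (S : set T) `|` ~` (S : set T)) k x.
      by rewrite setUv.
    rewrite (integral_setU mu mS (measurableC mS)).
    - by rewrite addeAC subee ?add0e//; exact: fin.
    - by rewrite setUv; exact: measurable_int intk.
    - by rewrite disj_set2E setICr.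
  by rewrite !splitS// fhS fh.
- move=> F mF tF fhF.
  have {}mF n : d.-measurable (F n : set T) by exact: sGm (mF n).
  have mUF : d.-measurable (\bigcup_k F k : set T) by exact: bigcupT_measurable.
  rewrite !integral_bigcup//; last 2 first.
  + exact: integrableS inth.
  + exact: integrableS intf.
  by apply: eq_eseriesr => k _; exact: fhF.
Qed.

End pi_system_integral.

(** * Shifts, stationarity and conditioning on the past *)

Section path_space_law.
Set Implicit Arguments.
Unset Strict Implicit.
Local Open Scope ereal_scope.
Context {d} {X : measurableType d} {R : realType} {T : realDomainType}.
Implicit Types (A B : T -> set X) (ts us : seq T) (t u : T).

Lemma cylinderI ts us A B : exists2 C : T -> set X,
  ((forall t, measurable (A t)) -> (forall t, measurable (B t)) ->
    forall t, measurable (C t)) &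
  cylinder ts A `&` cylinder us B = cylinder (ts ++ us) C.
Proof.
exists (fun t => (if t \in ts then A t else setT) `&`
                 (if t \in us then B t else setT)).
  by move=> mA mB t; apply: measurableI; case: ifP.
apply/seteqP; split=> w.
  move=> [wA wB] t; rewrite mem_cat => _.
  by split; case: ifPn => // tin; [exact: wA|exact: wB].
move=> wC; split=> t tin; have := wC t; rewrite mem_cat tin ?orbT => /(_ erefl)[]//.
Qed.

Lemma cylinders_setI_closed : setI_closed (@cylinders d X T).
Proof.
move=> _ _ [ts [A [mA ->]]] [us [B [mB ->]]].
have [C mC ->] := cylinderI ts us A B.
by exists (ts ++ us), C; split => //; exact: mC.
Qed.

(** A pi-system generating the sigma-algebra of the past of time 0, time 0 included. *)
Definition past_cylinders : set (set (path_space X T)) :=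
  [set C | exists ts A, [/\ forall t, measurable (A t),
    {in ts, forall t, (t <= 0)%R} & C = cylinder ts A]].

Lemma past_cylinders_setI_closed : setI_closed past_cylinders.
Proof.
move=> _ _ [ts [A [mA ts0 ->]]] [us [B [mB us0 ->]]].
have [C mC ->] := cylinderI ts us A B.
exists (ts ++ us), C; split => //; first exact: mC.
by move=> t; rewrite mem_cat => /orP[]; [exact: ts0|exact: us0].
Qed.

Lemma past_cylinders_setT : past_cylinders setT.
Proof.
exists [::], (fun=> setT); split => //.
by apply/seteqP; split.
Qed.

Lemma past_cylinders_measurable : past_cylinders `<=` measurable.
Proof. by move=> _ [ts [A [mA _ ->]]]; exact: measurable_cylinder. Qed.

(** [canonical_law] speaks of strictly increasing lists of times only; every cylinder is brought to
    that form. *)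
Lemma cylinder_sorted ts A :
  cylinder ts A = cylinder (sort <=%R (undup ts)) A.
Proof. by apply: eq_mem_cylinder => t; rewrite mem_sort mem_undup. Qed.

Lemma sorted_sort_undup ts : sorted <%R (sort <=%R (undup ts)).
Proof. by rewrite sort_lt_sorted undup_uniq. Qed.

Lemma preimage_path_shift_cylinder u ts A :
  path_shift u @^-1` (cylinder ts A : set (path_space X T)) =
  cylinder [seq (u + t)%R | t <- ts] (fun t => A (t - u)%R).
Proof.
apply/seteqP; split=> w.
  move=> wA _ /mapP[t tts ->]; rewrite /= [X in A X](_ : _ = t); first exact: wA.
  by rewrite [(u + t)%R]addrC addrK.
move=> wA t tts; have := wA (u + t)%R (map_f _ tts).
by rewrite /= [X in A X](_ : _ = t)// [(u + t)%R]addrC addrK.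
Qed.

Lemma measurable_path_shift u :
  measurable_fun [set: path_space X T] (@path_shift d X T u).
Proof.
apply: (@measurability _ _ (path_space X T) (path_space X T) setT
  (path_shift u) (@cylinders d X T) erefl) => _ [_ [ts [A [mA ->]]] <-].
by rewrite setTI preimage_path_shift_cylinder; exact: measurable_cylinder.
Qed.

Lemma measurable_preimage_path_shift u (B : set (path_space X T)) : measurable B ->
  measurable (path_shift u @^-1` B).
Proof.
by move=> mB; rewrite -[X in measurable X]setTI; exact: measurable_path_shift.
Qed.

Lemma path_shiftD u t (w : path_space X T) :
  path_shift u (path_shift t w) = path_shift (t + u)%R w.
Proof. by apply/funext => s; rewrite /path_shift addrA. Qed.

Lemma path_shift0 (w : path_space X T) : path_shift 0%R w = w.
Proof. by apply/funext => s; rewrite /path_shift add0r. Qed.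

Variables (Pt : T -> R.-pker X ~> X) (rho : probability X R).

(** Only differences of consecutive times enter the transition kernels. *)
Lemma fdd_from_shift A u t x ts :
  fdd_from Pt (fun s => A (s - u)%R) (u + t)%R x [seq (u + s)%R | s <- ts] =
  fdd_from Pt A t x ts.
Proof.
elim: ts t x => //= s ts IH t x.
rewrite opprD addrACA subrr add0r [(u + s - u)%R]addrAC subrr add0r.
by apply: eq_integral => y _; exact: IH.
Qed.

Lemma fdd_from_le1 A t x ts : (forall t, measurable (A t)) ->
  fdd_from Pt A t x ts <= 1.
Proof.
move=> mA; elim: ts t x => //= s ts IH t x.
apply: (@le_trans _ _ (\int[Pt (s - t)%R x]_(y in A s) 1)).
  apply: ge0_le_integral => //.
  - by move=> y _; exact: fdd_from_ge0.
  - exact/measurable_funTS/measurable_fdd_from.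
rewrite integral_cst// mul1e -(@prob_kernel _ _ _ _ _ (Pt (s - t)%R) x).
by rewrite le_measure ?inE.
Qed.

Variable Q : probability (path_space X T) R.
Hypothesis HQ : canonical_law Pt rho Q.

(** In [fdd] the law at the first listed time is always [rho], and afterwards only time differences
    count, so both laws agree on the pi-system of cylinders. The shift [u] may be negative. *)
Lemma canonical_stationary u C : measurable C ->
  Q (path_shift u @^-1` C) = Q C.
Proof.
move=> mC.
rewrite -[LHS]/(pushforward Q (@path_shift d X T u) C).
refine (@measure_unique _ R (path_space X T) (@cylinders d X T) (fun=> setT)
  erefl cylinders_setI_closed _ _
  (measure_function_pushforward__canonical__measure_function_Measure Q
    (measurable_path_shift u)) Q _ _ _ mC).
- move=> _; exists [::], (fun=> setT); split => //.
  by apply/seteqP; split.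
- by rewrite bigcup_const.
- move=> _ [ts [A [mA ->]]].
  rewrite /= /pushforward cylinder_sorted.
  have := sorted_sort_undup ts; set us := sort _ _ => sus.
  rewrite preimage_path_shift_cylinder !HQ//; last first.
    by rewrite sorted_map; under eq_sorted do rewrite /relpre/= ltrD2l.
  case: us {sus} => //= s us.
  rewrite [(u + s - u)%R]addrAC subrr add0r.
  by apply: eq_integral => x _; exact: fdd_from_shift.
- by move=> _ /=; rewrite /pushforward preimage_setT probability_setT ltry.
Qed.

(** [g x] is the probability that a path started from [x] at time 0 satisfies the constraints at the
    times [us]; the point is that one [g] serves all past events [C]. *)
Lemma canonical_markov_past us B : (forall t, measurable (B t)) ->
  {in us, forall t, (0 < t)%R} ->
  exists g : X -> R, [/\ measurable_fun setT g, forall x, (0 <= g x <= 1)%R &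
  forall C, past_cylinders C ->
    Q (C `&` cylinder us B) = \int[Q]_(w in C) (g (w 0%R))%:E].
Proof.
move=> mB us0; rewrite cylinder_sorted.
have := sorted_sort_undup us; set vs := sort _ _ => svs.
have {us0} vs0 : {in vs, forall t, (0 < t)%R}.
  by move=> t; rewrite mem_sort mem_undup; exact: us0.
have gE x : (fine (fdd_from Pt B 0 x vs))%:E = fdd_from Pt B 0 x vs.
  rewrite fineK// ge0_fin_numE ?fdd_from_ge0//.
  by rewrite (le_lt_trans (fdd_from_le1 _ _ _ _)) ?ltry.
exists (fun x => fine (fdd_from Pt B 0 x vs)); split.
- apply/measurable_EFinP.
  rewrite (_ : _ \o _ = fun x => fdd_from Pt B 0 x vs); last exact/funext.
  exact: measurable_fdd_from.
- by move=> x; rewrite -!lee_fin gE fdd_from_ge0 fdd_from_le1.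
move=> _ [ts [A [mA ts0 ->]]].
under eq_integral do rewrite gE.
(* [A'] merges the past and future constraints into one family. Time 0 has to be the conditioning
   time even if [ts] omits it, and then [A'] puts the whole space there. *)
pose A' t := if (t <= 0)%R then if t \in ts then A t else setT else B t.
have mA' t : measurable (A' t) by rewrite /A'; case: ifP => //; case: ifP.
pose ts' := sort <=%R (undup [seq t <- ts | (t < 0)%R]).
have ts'0 : {in ts', forall t, (t < 0)%R}.
  by move=> t; rewrite mem_sort mem_undup mem_filter => /andP[].
have AA' : cylinder ts A = cylinder (rcons ts' 0%R) A'.
  apply/seteqP; split=> w wA t.
    rewrite mem_rcons inE => /orP[/eqP ->|tts']; rewrite /A' ?lexx.
      by case: ifP => // t0; exact: wA.
    by rewrite (ltW (ts'0 _ tts')); case: ifP => // tts; exact: wA.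
  move=> tts; have := wA t.
  rewrite /A' (ts0 _ tts) tts; apply.
  rewrite mem_rcons inE mem_sort mem_undup mem_filter tts andbT.
  by rewrite -le_eqVlt ts0.
have BA' : {in vs, B =1 A'}.
  by move=> t tvs; rewrite /A' leNgt vs0.
rewrite AA' (eq_cylinder BA') -cylinder_cat.
rewrite (canonical_markov_cylinder HQ)//.
  by apply: eq_integral => w _; apply: eq_fdd_from => t tvs; rewrite BA'.
rewrite sorted_pairwise; last exact: lt_trans.
rewrite pairwise_cat pairwise_rcons -!sorted_pairwise; try exact: lt_trans.
rewrite svs sorted_sort_undup !andbT; apply/andP; split; last first.
  by apply/allP => t /ts'0.
apply/allrelP => s t; rewrite mem_rcons inE => /orP[/eqP ->|/ts'0 s0] /vs0// t0.
exact: lt_trans t0.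
Qed.

End path_space_law.

(** * Approximation of indicators in L^1 *)

Lemma measurable_setY {d : measure_display} {T : measurableType d} {A B : set T} :
  measurable A -> measurable B -> measurable (A `+` B).
Proof. by move=> mA mB; apply: measurableU; exact: measurableD. Qed.

Section L1_approximation.
Set Implicit Arguments.
Unset Strict Implicit.
Local Open Scope ereal_scope.
Context {d} {T : measurableType d} {R : realType}.
Variable mu : probability T R.

Lemma measurable_EFin_normB (f g : T -> R) :
  measurable_fun setT f -> measurable_fun setT g ->
  measurable_fun setT (fun x => `|f x - g x|%:E).
Proof.
move=> mf mg; apply/measurable_EFinP; apply: measurableT_comp => //.
exact: measurable_funB.
Qed.

Lemma le_integral_normD (a b c : T -> R) :
  measurable_fun setT a -> measurable_fun setT b -> measurable_fun setT c ->
  (forall x, `|a x| <= `|b x| + `|c x|)%R ->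
  \int[mu]_x `|a x|%:E <= \int[mu]_x `|b x|%:E + \int[mu]_x `|c x|%:E.
Proof.
move=> ma mb mc abc.
have mn (f : T -> R) : measurable_fun setT f ->
    measurable_fun setT (fun x => `|f x|%:E).
  by move=> mf; apply/measurable_EFinP; exact: measurableT_comp.
rewrite -ge0_integralD//; [|exact: mn|exact: mn].
apply: ge0_le_integral => //; first exact: mn.
- by apply: emeasurable_funD; exact: mn.
- by move=> x _; rewrite -EFinD lee_fin.
Qed.

Lemma integral_norm_subr_indic (A B : set T) : measurable A -> measurable B ->
  \int[mu]_x `|\1_A x - \1_B x|%:E = mu (A `+` B).
Proof.
move=> mA mB; have mAB := measurable_setY mA mB.
rewrite -[in RHS](setIT (A `+` B)) -integral_indic//.
apply: eq_integral => x _; congr (_%:E); rewrite !indicE.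
rewrite /setY in_setU !in_setD.
case: (x \in A); case: (x \in B) => /=;
  by rewrite ?subrr ?normr0 ?sub0r ?subr0 ?normrN ?normr1.
Qed.

(** The sets with approximable indicator form a Dynkin system: [1 - f] handles complements, and a
    countable disjoint union is first cut to finitely many terms at the cost of a small measure.
    Closure of [V] under differences yields zero and sums, which is all the linearity that
    indicators require. *)
Lemma L1_approximation (G : set (set T)) (V : set (T -> R)) :
  @measurable _ T = <<s G >> -> setI_closed G -> G setT ->
  (forall f, V f -> measurable_fun setT f) ->
  (forall C, G C -> V \1_C) ->
  (forall f g, V f -> V g -> V (fun x => f x - g x)%R) ->
  forall A, measurable A -> forall e : R, (0 < e)%R ->
  exists2 f, V f & \int[mu]_x `|\1_A x - f x|%:E < e%:E.
Proof.
move=> mG GI GT mV V1 VB A mA.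
have V0 : V (fun=> 0%R).
  rewrite (_ : (fun=> 0%R) = (fun x => \1_setT x - \1_setT x)%R).
    by apply: VB; exact: V1.
  by apply/funext => x; rewrite subrr.
have VD f g : V f -> V g -> V (fun x => f x + g x)%R.
  move=> Vf Vg; rewrite (_ : (fun x => _) = (fun x => f x - (0 - g x))%R).
    by apply: (VB) => //; exact: VB.
  by apply/funext => x; rewrite sub0r opprK.
have mI (B : set T) : measurable B -> measurable_fun setT (\1_B : T -> R).
  exact: measurable_indic.
have mIf (B : set T) f : measurable B -> V f ->
    measurable_fun setT (fun x => \1_B x - f x)%R.
  by move=> mB Vf; apply: measurable_funB; [exact: mI|exact: mV].
pose P B := forall e : R, (0 < e)%R ->
  exists2 f, V f & \int[mu]_x `|\1_B x - f x|%:E < e%:E.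
have GP B : G B -> P B.
  move=> GB e e0; exists \1_B; first exact: V1.
  by under eq_integral do rewrite subrr normr0; rewrite integral0 lte_fin.
rewrite mG in mA; apply: (dynkin_induction (P := P) mG GI) A mA => //.
- exact: GP.
- move=> S mS PS e e0; have [f Vf fe] := PS e e0.
  exists (fun x => \1_setT x - f x)%R; first by apply: VB => //; exact: V1.
  rewrite (eq_integral (fun x => `|\1_S x - f x|%:E))// => x _.
  rewrite -normrN; congr (`| _ |%:E).
  by rewrite opprB !indicE in_setT in_setC; case: (_ \in _) => /=; lra.
move=> F mF tF PF.
(* Finite unions come first: disjointness makes the indicator of [U n.+1] a sum, and the error is
   halved at each step of the induction. *)
pose U n := \big[setU/set0]_(k < n) F k.
have mU n : measurable (U n) by apply: bigsetU_measurable.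
have PU n : P (U n).
  rewrite /U; elim: n => [|n IH] e e0.
    exists (fun=> 0%R) => //; rewrite big_ord0.
    under eq_integral do rewrite indic0 subrr normr0.
    by rewrite integral0 lte_fin.
  have e20 : (0 < e / 2)%R by rewrite divr_gt0.
  have [f Vf fe] := IH _ e20; have [g Vg ge] := PF n _ e20.
  exists (fun x => f x + g x)%R; first exact: VD.
  rewrite big_ord_recr/= -/(U n).
  apply: (@le_lt_trans _ _ (\int[mu]_x `|\1_(U n) x - f x|%:E +
      \int[mu]_x `|\1_(F n) x - g x|%:E)); last first.
    by rewrite [e in ltRHS](splitr e) EFinD lteD.
  apply: le_integral_normD; [|exact: mIf|exact: mIf|].
    by apply: mIf; [exact: measurableU|exact: VD].
  move=> x; rewrite (_ : \1_(U n `|` F n) x = \1_(U n) x + \1_(F n) x)%R.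
    by rewrite opprD addrACA ler_normD.
  rewrite !indicE in_setU.
  have [xU|] := boolP (x \in U n); last by rewrite add0r.
  have [xF|] := boolP (x \in F n); last by rewrite addr0.
  move: xU xF; rewrite !inE /U -bigcup_mkord => -[k /= kn Fk] Fn.
  have := tF k n I I; move/(_ (ex_intro _ x (conj Fk Fn))) => kn'.
  by rewrite kn' ltnn in kn.
move=> e e0; have e20 : (0 < e / 2)%R by rewrite divr_gt0.
have mUF : measurable (\bigcup_k F k) by exact: bigcupT_measurable.
have UF n : U n `<=` \bigcup_k F k.
  by rewrite /U -bigcup_mkord => y [k _ Fk]; exists k.
(* The remainders decrease to the empty set, so continuity from above would contradict a uniform
   lower bound [e / 2]. *)
have [n ne] : exists n, mu ((\bigcup_k F k) `\` U n) < (e / 2)%:E.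
  apply: contrapT => /forallNP noU.
  suff : (e / 2)%:E <= mu (\bigcap_n ((\bigcup_k F k) `\` U n)).
    rewrite (_ : \bigcap_n _ = set0) ?measure0 ?lee_fin ?leNgt ?e20//.
    rewrite -subset0 => y yD; have [[k _ Fk] _] := yD 0%N I.
    have [_] := yD k.+1 I; apply; rewrite /U -bigcup_mkord.
    by exists k => //=.
  apply: (@cvge_ge _ \oo _ _ (fun n => mu ((\bigcup_k F k) `\` U n))).
    by apply: nearW => n; rewrite leNgt; apply/negP; exact: noU.
  apply: nonincreasing_cvg_mu.
  - by rewrite (le_lt_trans (probability_le1 _ _)) ?ltry//; exact: measurableD.
  - by move=> n; exact: measurableD.
  - by apply: bigcapT_measurable => n; exact: measurableD.
  - move=> n m nm; apply/subsetPset; apply: setDS.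
    by rewrite /U -!bigcup_mkord => y [k /= kn Fk]; exists k => //=; exact: leq_trans nm.
have {}ne : mu ((\bigcup_k F k) `+` U n) < (e / 2)%:E.
  by rewrite /setY (_ : U n `\` _ = set0) ?setU0// -subset0 => y [/UF].
have [f Vf fe] := PU n _ e20.
exists f => //.
apply: (@le_lt_trans _ _ (\int[mu]_x `|\1_(\bigcup_k F k) x - \1_(U n) x|%:E +
      \int[mu]_x `|\1_(U n) x - f x|%:E)); last first.
  by rewrite [e in ltRHS](splitr e) EFinD lteD// integral_norm_subr_indic.
apply: le_integral_normD; [exact: mIf| |exact: mIf|].
  by apply: measurable_funB; exact: mI.
by move=> x; rewrite -[X in (`|X| <= _)%R](subrKA (\1_(U n) x)) ler_normD.
Qed.

End L1_approximation.

(** * Conditional expectation contracts L^1 *)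

Section conditioning_contraction.
Set Implicit Arguments.
Unset Strict Implicit.
Local Open Scope ereal_scope.
Context {d} {T : measurableType d} {R : realType}.
Variable mu : {measure set T -> \bar R}.

(* If [g] is the conditional expectation of [phi] given [<<s G>>], then
   [psi - g] is that of [psi - phi]. *)
Lemma conditional_L1_contraction (G : set (set T)) (psi phi g : T -> R) :
  G `<=` measurable ->
  measurable_fun [set: g_sigma_algebraType G] psi ->
  measurable_fun [set: g_sigma_algebraType G] g ->
  mu.-integrable setT (EFin \o psi) -> mu.-integrable setT (EFin \o phi) ->
  mu.-integrable setT (EFin \o g) ->
  (forall B, <<s G >> B ->
    \int[mu]_(x in B) (phi x)%:E = \int[mu]_(x in B) (g x)%:E) ->
  \int[mu]_x `|psi x - g x|%:E <= \int[mu]_x `|psi x - phi x|%:E.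
Proof.
move=> Gm mpsi mg ipsi iphi ig phig.
have sGm : <<s G >> `<=` measurable.
  by apply: smallest_sub Gm; exact: sigma_algebra_measurable.
(* [psi - g] has constant sign on [B] and on its complement, and both lie in [<<s G>>]: there the
   absolute value can be removed, [g] replaced by [phi] under the integral, and the absolute value
   restored as an upper bound. *)
pose B : set T := [set x | g x <= psi x]%R.
have sB : <<s G >> B.
  have /(_ measurableT [set true] I) := measurable_fun_ler mg mpsi.
  by rewrite setTI.
have sNB : <<s G >> (~` B) by exact: (@measurableC _ (g_sigma_algebraType G) B sB).
have mB : d.-measurable B by exact: sGm.
have mNB : d.-measurable (~` B) by exact: sGm.
have mabs (f h : T -> R) : mu.-integrable setT (EFin \o f) ->
    mu.-integrable setT (EFin \o h) ->
    measurable_fun setT (fun x => `|f x - h x|%:E).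
  move=> /measurable_int/measurable_EFinP mf /measurable_int/measurable_EFinP mh.
  by apply/measurable_EFinP/measurableT_comp => //; exact: measurable_funB.
have split f h : mu.-integrable setT (EFin \o f) ->
    mu.-integrable setT (EFin \o h) ->
    \int[mu]_x `|f x - h x|%:E =
    \int[mu]_(x in B) `|f x - h x|%:E + \int[mu]_(x in ~` B) `|f x - h x|%:E.
  move=> intf inth; rewrite -ge0_integral_setU ?setUv//; first exact: mabs.
  by rewrite disj_set2E setICr.
have iS D f : d.-measurable D -> mu.-integrable setT (EFin \o f) ->
    mu.-integrable D (EFin \o f).
  by move=> mD; exact: integrableS.
have intB D f h : d.-measurable D -> mu.-integrable setT (EFin \o f) ->
    mu.-integrable setT (EFin \o h) ->
    \int[mu]_(x in D) (f x - h x)%:E =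
    \int[mu]_(x in D) (f x)%:E - \int[mu]_(x in D) (h x)%:E.
  by move=> mD intf inth; rewrite integralB_EFin//; exact: iS.
have lenorm D f h : d.-measurable D -> mu.-integrable setT (EFin \o f) ->
    mu.-integrable setT (EFin \o h) ->
    \int[mu]_(x in D) (f x - h x)%:E <= \int[mu]_(x in D) `|f x - h x|%:E.
  move=> mD intf inth.
  have ifh : mu.-integrable D (fun x => (f x - h x)%:E).
    apply: eq_integrable (integrableB mD (iS _ _ mD intf) (iS _ _ mD inth)) => //.
  apply: le_integral => //; first exact: integrable_abse ifh.
  by move=> x _; rewrite lee_fin ler_norm.
rewrite (split psi g)// (split psi phi)// leeD//.
- rewrite (eq_integral (fun x => (psi x - g x)%:E)); last first.
    by move=> x; rewrite inE /B/= => gp; rewrite ger0_norm ?subr_ge0.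
  by rewrite intB// -phig// -intB// lenorm.
- rewrite (eq_integral (fun x => (g x - psi x)%:E)); last first.
    move=> x; rewrite inE /B/= => /negP; rewrite -ltNge => gp.
    by rewrite distrC gtr0_norm ?subr_gt0.
  rewrite intB// -phig// -intB//; under [leRHS]eq_integral do rewrite distrC.
  exact: lenorm.
Qed.

End conditioning_contraction.

(** * Invariant events are approximated by events at time 0 *)

Section invariant_events.
Set Implicit Arguments.
Unset Strict Implicit.
Local Open Scope ereal_scope.
Context {d} {X : measurableType d} {R : realType} {T : realDomainType}.
Implicit Types (A B : set (path_space X T)) (ts us : seq T) (t u : T).
Variables (Pt : T -> R.-pker X ~> X) (rho : probability X R).
Variable Q : probability (path_space X T) R.
Hypothesis HQ : canonical_law Pt rho Q.

Let past := @past_cylinders d X T.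

(** The class standing for linear combinations of cylinder indicators. Its clauses record what is
    required of far shifts: towards the past they are past-measurable, and towards the future their
    conditional expectation given the past is a function of [w 0]. *)
Definition shift_approximable : set (path_space X T -> R) :=
  [set f : path_space X T -> R | [/\ Q.-integrable setT (EFin \o f) &
    exists N : T, forall u, (N <= u)%R ->
    measurable_fun [set: g_sigma_algebraType past] (f \o path_shift (- u)%R) /\
    exists g : X -> R, [/\ measurable_fun setT g,
      Q.-integrable setT (fun w => (g (w 0%R))%:E) &
      forall C, past C -> \int[Q]_(w in C) (f (path_shift u w))%:E =
                          \int[Q]_(w in C) (g (w 0%R))%:E]]].

Lemma ge0_integral_path_shift u (f : path_space X T -> \bar R) :
  measurable_fun setT f -> (forall w, 0 <= f w) ->
  \int[Q]_w f (path_shift u w) = \int[Q]_w f w.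
Proof.
move=> mf f0.
rewrite -(preimage_setT (@path_shift d X T u)).
rewrite -(ge0_integral_pushforward (measurable_path_shift u) Q measurableT)//.
apply: eq_measure_integral; first exact: measurable_path_shift.
by move=> ? C mC _; exact: canonical_stationary HQ u C mC.
Qed.

Lemma integrable_path_shift u (f : path_space X T -> R) :
  Q.-integrable setT (EFin \o f) ->
  Q.-integrable setT (EFin \o (f \o path_shift u)).
Proof.
move=> /integrableP[mf intf]; apply/integrableP; split.
  exact: measurableT_comp mf (measurable_path_shift u).
rewrite (@ge0_integral_path_shift u (fun w => `|(f w)%:E|))//.
exact: measurableT_comp mf.
Qed.

Lemma shift_approximable_cylinder C : cylinders C -> shift_approximable \1_C.
Proof.
move=> [ts [A [mA ->]]].
have mC : measurable (cylinder ts A : set (path_space X T)).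
  exact: measurable_cylinder.
split; first exact: integrable_indic.
(* The sum bounds each [|t|] and the added 1 makes the bound strict: for [u >= N] the times [t - u]
   are nonpositive and the times [u + t] positive. *)
pose N : T := (1 + \sum_(t <- ts) `|t|)%R.
have leN t : t \in ts -> (`|t| < N)%R.
  move=> tts; rewrite /N (big_rem _ tts)/= ltr_pwDl// lerDl sumr_ge0//.
exists N => u Nu; split.
  rewrite (_ : _ \o _ = \1_(path_shift (- u) @^-1` cylinder ts A)) //.
  apply: measurable_indic; apply: sub_sigma_algebra.
  rewrite preimage_path_shift_cylinder.
  exists [seq (- u + t)%R | t <- ts], (fun t => A (t - - u)%R); split => //.
  move=> _ /mapP[t tts ->]; rewrite addrC subr_le0.
  exact: le_trans (ler_norm t) (le_trans (ltW (leN t tts)) Nu).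
have us0 : {in [seq (u + t)%R | t <- ts], forall t, (0 < t)%R}.
  move=> _ /mapP[t tts ->]; rewrite -(opprK t) subr_gt0.
  by rewrite (le_lt_trans (ler_norm _))// normrN (lt_le_trans (leN t tts)).
have [g [mg g01 gE]] := canonical_markov_past HQ (fun t => mA (t - u)%R) us0.
have mg0 : measurable_fun [set: path_space X T]
    (fun w : path_space X T => (g (w 0%R))%:E).
  by apply/measurable_EFinP; exact: measurableT_comp mg (measurable_coord 0%R).
exists g; split => //.
- apply: le_integrable (finite_measure_integrable_cst Q 1 measurableT) => //.
  move=> w _ /=; rewrite lee_fin normr1.
  by have /andP[g0 g1] := g01 (w 0%R); rewrite ger0_norm.
- move=> B pB; rewrite -gE//.
  have mD := measurable_preimage_path_shift u mC.
  rewrite (eq_integral (fun w =>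
    (\1_(path_shift u @^-1` (cylinder ts A : set (path_space X T))) w)%:E))//.
  rewrite integral_indic//; last exact: past_cylinders_measurable.
  by rewrite setIC preimage_path_shift_cylinder.
Qed.

Lemma shift_approximableB f g : shift_approximable f -> shift_approximable g ->
  shift_approximable (fun w => f w - g w)%R.
Proof.
move=> [intf [N1 f1]] [intg [N2 g1]]; split.
  exact: eq_integrable (integrableB measurableT intf intg).
exists (Num.max N1 N2) => u; rewrite ge_max => /andP[Nu1 Nu2].
have [mf [gf [mgf igf fE]]] := f1 u Nu1.
have [mg [gg [mgg igg gE]]] := g1 u Nu2.
split; first exact: measurable_funB.
exists (fun x => gf x - gg x)%R; split.
- exact: measurable_funB.
- exact: eq_integrable (integrableB measurableT igf igg).
- move=> C pC; have mC : measurable C by exact: past_cylinders_measurable pC.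
  rewrite integralB_EFin//; first last.
    by apply: integrableS (integrable_path_shift u intg).
    by apply: integrableS (integrable_path_shift u intf).
  rewrite [RHS]integralB_EFin//; first last.
    exact: integrableS igg.
    exact: integrableS igf.
  by rewrite fE// gE.
Qed.

Variable A : set (path_space X T).
Hypothesis mA : measurable A.
Hypothesis invA : forall t, (0 <= t)%R -> Q (A `+` (path_shift t @^-1` A)) = 0.

(** For negative [u], stationarity under the shift by [- u] carries the event to the symmetric
    difference belonging to the nonnegative time [- u]. *)
Lemma invariant_path_shift u : Q (A `+` (path_shift u @^-1` A)) = 0.
Proof.
have [u0|u0] := leP 0%R u; first exact: invA.
have mS := measurable_setY mA (measurable_preimage_path_shift u mA).
rewrite -(canonical_stationary HQ (- u)%R mS).
rewrite -[X in Q X]/(path_shift (- u) @^-1` A `+`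
  (path_shift (- u) @^-1` (path_shift u @^-1` A))).
rewrite -comp_preimage (_ : path_shift u \o path_shift (- u) = id); last first.
  by apply/funext => w /=; rewrite path_shiftD addNr path_shift0.
rewrite preimage_id setYC.
by apply: invA; rewrite oppr_ge0 ltW.
Qed.

(** Almost surely [\1_A] can be shifted together with [f]; stationarity then removes the shift from
    both. *)
Lemma integral_invariant_shift u (f : path_space X T -> R) :
  measurable_fun setT f ->
  \int[Q]_w `|\1_A w - f (path_shift u w)|%:E = \int[Q]_w `|\1_A w - f w|%:E.
Proof.
move=> mf; rewrite -(@ge0_integral_path_shift u (fun w => `|\1_A w - f w|%:E))//.
  pose N := A `+` (path_shift u @^-1` A).
  have mu_ : measurable (path_shift u @^-1` A : set (path_space X T)).
    exact: measurable_preimage_path_shift.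
  have mfu : measurable_fun setT (fun w => f (path_shift u w)).
    exact: measurableT_comp mf (measurable_path_shift u).
  have mI : measurable_fun setT (\1_A : path_space X T -> R) by exact: measurable_indic.
  apply: ae_eq_integral => //.
  - exact: measurable_EFin_normB.
  - apply: measurable_EFin_normB => //.
    exact: measurableT_comp mI (measurable_path_shift u).
  exists N; split; [|exact: invariant_path_shift|].
    exact: measurable_setY.
  move=> w /= /not_implyP[_ neq]; apply: contrapT => Nw; apply: neq.
  suff -> : (\1_A w : R) = \1_A (path_shift u w) by [].
  rewrite !indicE; congr (nat_of_bool _)%:R; apply/idP/idP; rewrite !inE => Aw;
    apply: contrapT => nAw; apply: Nw; [by left|by right].
by apply: measurable_EFin_normB => //; exact: measurable_indic.
Qed.

(** Both the past shift [psi] and the future shift [phi] of [f] are close to [\1_A], hence to each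
    other. Conditioning on the past fixes [psi] and sends [phi] to [g (w 0)], so by contraction
    [g (w 0)] is close to [psi], thus to [\1_A]; a level set of [g] then approximates [A]. *)
Lemma invariant_event_approx (e : R) : (0 < e)%R ->
  exists2 G : set X, measurable G &
    Q (A `+` (fun w : T -> X => w 0%R) @^-1` G) < e%:E.
Proof.
(* The triangle inequality adds three errors [e / 6], and thresholding [g] doubles the resulting
   [e / 2]. *)
move=> e0; have e60 : (0 < e / 6)%R by rewrite divr_gt0.
have [f [intf [N fN]] fe] : exists2 f, shift_approximable f &
    \int[Q]_w `|\1_A w - f w|%:E < (e / 6)%:E.
  apply: (@L1_approximation _ _ _ Q (@cylinders d X T) shift_approximable) => //.
  - exact: cylinders_setI_closed.
  - exists [::], (fun=> setT); split => //.
    by apply/seteqP; split.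
  - by move=> f [/measurable_int/measurable_EFinP].
  - exact: shift_approximable_cylinder.
  - exact: shift_approximableB.
have [mpsi [g [mg ig gE]]] := fN N (lexx _).
set psi := f \o path_shift (- N) in mpsi.
pose phi := f \o path_shift N.
have ipsi : Q.-integrable setT (EFin \o psi) by exact: integrable_path_shift.
have iphi : Q.-integrable setT (EFin \o phi) by exact: integrable_path_shift.
have mf : measurable_fun setT f by move: intf => /measurable_int/measurable_EFinP.
have mI : measurable_fun setT (\1_A : path_space X T -> R) by exact: measurable_indic.
have mg0 : measurable_fun setT (fun w : path_space X T => g (w 0%R)).
  exact: measurableT_comp mg (measurable_coord 0%R).
have mps : measurable_fun setT psi by move: ipsi => /measurable_int/measurable_EFinP.
have mph : measurable_fun setT phi by move: iphi => /measurable_int/measurable_EFinP.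
have psie : \int[Q]_w `|\1_A w - psi w|%:E < (e / 6)%:E.
  by rewrite integral_invariant_shift.
have phie : \int[Q]_w `|\1_A w - phi w|%:E < (e / 6)%:E.
  by rewrite integral_invariant_shift.
have ge : \int[Q]_w `|\1_A w - g (w 0%R)|%:E < (e / 2)%:E.
  apply: (@le_lt_trans _ _ (\int[Q]_w `|\1_A w - psi w|%:E +
      \int[Q]_w `|psi w - g (w 0%R)|%:E)).
    apply: le_integral_normD; try exact: measurable_funB.
    by move=> w; rewrite -[X in (`|X| <= _)%R](subrKA (psi w)) ler_normD.
  apply: (@le_lt_trans _ _ (\int[Q]_w `|\1_A w - psi w|%:E +
      (\int[Q]_w `|\1_A w - psi w|%:E + \int[Q]_w `|\1_A w - phi w|%:E))).
    rewrite leeD2l//; apply: (@le_trans _ _ (\int[Q]_w `|psi w - phi w|%:E)).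
      apply: (@conditional_L1_contraction _ _ _ Q past) => //.
      - exact: past_cylinders_measurable.
      - apply: measurableT_comp mg _.
        move=> _ U mU; rewrite setTI; apply: sub_sigma_algebra.
        exists [:: 0%R], (fun=> U); split=> //.
          by move=> t; rewrite inE => /eqP ->.
        by rewrite cylinder1.
      - apply: eq_integral_g_sigma => //.
        + exact: past_cylinders_measurable.
        + exact: past_cylinders_setI_closed.
        + exact: past_cylinders_setT.
    apply: le_integral_normD; try exact: measurable_funB.
    move=> w; rewrite distrC (_ : phi w - psi w = (\1_A w - psi w) - (\1_A w - phi w))%R.
      exact: ler_normB.
    by rewrite opprB addrACA addrC !addrA; lra.
  rewrite (_ : e / 2 = e / 6 + (e / 6 + e / 6))%R; last by lra.
  by rewrite !EFinD lteD// lteD.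
pose G : set X := [set x | 1 / 2 < g x]%R.
have mG : measurable G.
  have /(_ measurableT [set true] I) :=
    measurable_fun_ltr (measurable_cst (1 / 2 : R)%R) mg.
  by rewrite setTI.
exists G => //.
have mG0 := measurable_preimage_coord (0%R : T) mG.
rewrite -integral_norm_subr_indic//.
(* Where [\1_A] and the indicator of [w 0 \in G] differ, [g (w 0)] is at distance at least 1/2 from
   [\1_A]; hence the factor 2. *)
apply: (@le_lt_trans _ _ (2%:E * \int[Q]_w `|\1_A w - g (w 0%R)|%:E)).
  rewrite -ge0_integralZl//; last first.
    exact: measurable_EFin_normB.
  apply: ge0_le_integral => //.
  - by apply: measurable_EFin_normB => //; exact: measurable_indic.
  - apply: measurable_funeM.
    exact: measurable_EFin_normB.
  move=> w _; rewrite -EFinM lee_fin !indicE.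
  have [wG|wG] := boolP (w \in _ @^-1` G); have [wA|wA] := boolP (w \in A);
    rewrite /= ?subrr ?normr0 ?mulr_ge0//.
  - move: wG; rewrite inE /G /= => wG.
    by rewrite !sub0r !normrN normr1 ger0_norm; lra.
  - move: wG; rewrite notin_setE /G /= => /negP; rewrite -leNgt => wG.
    by rewrite subr0 normr1 ger0_norm; lra.
have fin : \int[Q]_w `|\1_A w - g (w 0%R)|%:E \is a fin_num.
  by rewrite ge0_fin_numE ?(lt_trans ge) ?ltry// integral_ge0.
by rewrite -(fineK fin) -EFinM lte_fin -ltr_pdivlMl// mulrC -lte_fin fineK.
Qed.

End invariant_events.

(** * A criterion for ergodicity in terms of invariant sets of states *)

Section ergodicity_criterion.
Set Implicit Arguments.
Unset Strict Implicit.
Local Open Scope ereal_scope.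
Context {d} {X : measurableType d} {R : realType} {T : realDomainType}.
Variables (Pt : T -> R.-pker X ~> X) (rho : probability X R).

Lemma setY_null_eq d' (S : measurableType d') (mu : {measure set S -> \bar R})
    (A B : set S) : measurable A -> measurable B -> mu (A `+` B) = 0 -> mu A = mu B.
Proof.
move=> mA mB AB0.
have mAB := measurableD mA mB; have mBA := measurableD mB mA.
have AB : mu (A `\` B) = 0.
  apply: subset_measure0 AB0 => //; last by move=> x; left.
  exact: measurableU.
have BA : mu (B `\` A) = 0.
  apply: subset_measure0 AB0 => //; last by move=> x; right.
  exact: measurableU.
rewrite (measureDI mu mA mB) [RHS](measureDI mu mB mA).
rewrite [X in X + _]AB [in RHS]setIC; congr (_ + _); exact/esym.

Qed.

(** Borel-Cantelli: take [G k] with error below [2 ^ -(k + 1)], a summable sequence, and let [G] be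
    the upper limit of the [G k]. A path in exactly one of [A] and the event [w 0 \in G] lies in
    infinitely many of the symmetric differences [F k], which has probability zero. *)
Lemma invariant_event_state (Q : probability (path_space X T) R)
    (A : set (path_space X T)) :
  canonical_law Pt rho Q -> measurable A ->
  (forall t, (0 <= t)%R -> Q (A `+` (path_shift t @^-1` A)) = 0) ->
  exists2 G : set X, measurable G &
    Q (A `+` (fun w : T -> X => w 0%R) @^-1` G) = 0.
Proof.
move=> HQ mA invA.
have r0 k : (0 < 1 / (2 ^ (k + 1))%:R :> R)%R by rewrite divr_gt0// ltr0n expn_gt0.
have /choice[G Gr] : forall k, exists G : set X, measurable G /\
    Q (A `+` (fun w : T -> X => w 0%R) @^-1` G) < (1 / (2 ^ (k + 1))%:R)%:E.
  by move=> k; have [G mG Ge] := invariant_event_approx HQ mA invA (r0 k); exists G.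
have mY (B : set X) : measurable B ->
    measurable (A `+` (fun w : path_space X T => w 0%R) @^-1` B).
  by move=> mB; apply: measurable_setY => //; exact: measurable_preimage_coord.
have mlim (U : measurableType d) (F : (set U)^nat) : (forall n, measurable (F n)) ->
    measurable (lim_sup_set F).
  move=> mF; apply: bigcapT_measurable => n; apply: bigcup_measurable => k _.
  exact: mF.
have mG : measurable (lim_sup_set G) by apply: mlim => n; have [] := Gr n.
exists (lim_sup_set G) => //.
pose F k : set (path_space X T) := A `+` (fun w : T -> X => w 0%R) @^-1` G k.
have mF k : measurable (F k) by apply: mY; have [] := Gr k.
have F0 : Q (lim_sup_set F) = 0.
  apply: lim_sup_set_cvg0 => //.
  apply: (@le_lt_trans _ _ (\sum_(0 <= k <oo) (1 / (2 ^ (k + 1))%:R)%:E)).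
    by apply: lee_nneseries => // k _; apply: ltW; have [] := Gr k.
  have /cvg_lim := @cvg_geometric_eseries_half R 1 0.
  by rewrite /eseries/= => ->//; rewrite ltry.
apply: subset_measure0 F0; [exact: mY| |].
  by apply: bigcapT_measurable => n; apply: bigcup_measurable => k _.
move=> w [[Aw nG]|[Gw nA]] n _.
- have [m _ nGm] : exists2 m, True & forall k, (m <= k)%N -> ~ G k (w 0%R).
    apply: contrapT => H; apply: nG => m _; apply: contrapT => H2; apply: H.
    by exists m => // k mk Gk; apply: H2; exists k.
  exists (maxn n m); first by rewrite /= leq_maxl.
  by left; split => //; apply: nGm; rewrite leq_maxr.
- have [k nk Gk] := Gw n I.
  by exists k => //; right.
Qed.

(** For each measurable [E], the integral of [Pt t x G] over [E] is the probability of [w 0 \in E]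
    and [w t \in G], which by assumption is that of [w 0 \in G] and [w 0 \in E], namely
    [rho (G :&: E)]. Functions with equal integrals over all [E] agree almost everywhere. *)
Lemma state_event_harmonic (Q : probability (path_space X T) R)
    (G : set X) (t : T) :
  canonical_law Pt rho Q -> measurable G -> (0 < t)%R ->
  Q ((fun w : T -> X => w 0%R) @^-1` G `+` (fun w : T -> X => w t) @^-1` G) = 0 ->
  {ae rho, forall x, Pt t x G = (\1_G x)%:E}.
Proof.
move=> HQ mG t0 GG0.
have mev := @measurable_preimage_coord _ X T.
have /= := @integral_ae_eq _ _ _ rho setT measurableT (fun x => (\1_G x)%:E)
  (fun x => Pt t x G).
have iP : rho.-integrable setT (fun x => Pt t x G).
  apply: le_integrable (finite_measure_integrable_cst rho 1 measurableT) => //.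
    exact: measurable_kernel.
  move=> x _ /=; rewrite gee0_abs// normr1.
  by rewrite -(@prob_kernel _ _ _ _ _ (Pt t) x) le_measure ?inE.
move=> /(_ iP) H.
have : ae_eq rho setT (fun x => Pt t x G) (fun x => (\1_G x)%:E).
  apply: H; first by apply/measurable_EFinP; exact: measurable_indic.
  move=> E _ mE; rewrite integral_indic//.
  pose A (s : T) := if s == 0%R then E else G.
  have mA s : measurable (A s) by rewrite /A; case: ifP.
  have s0t : sorted <%R [:: 0%R; t] by rewrite /= t0.
  transitivity (Q (cylinder [:: 0%R; t] A)).
    rewrite HQ//= {1}/A eqxx; apply: eq_integral => x _.
    by rewrite /A subr0 gt_eqF// integral_cst// mul1e.
  transitivity (Q ((fun w : T -> X => w 0%R) @^-1` (G `&` E))); last first.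
    exact: (canonical_coord0 HQ 0%R (measurableI _ _ mG mE)).
  rewrite -cat1s cylinder_cat !cylinder1 /A eqxx gt_eqF//.
  apply: setY_null_eq.
  - by apply: measurableI; exact: mev.
  - by apply: mev; exact: measurableI.
  apply: subset_measure0 GG0.
  - apply: measurable_setY; first by apply: measurableI; exact: mev.
    by apply: mev; exact: measurableI.
  - by apply: measurableU; apply: measurableD; exact: mev.
  - move=> w [[[Ew Gt] nG0]|[[G0 E0] n]]; [right|left]; split => //=.
      by move=> G0; apply: nG0.
    by move=> Gt; apply: n.
by apply: filterS => x /(_ I).
Qed.

Lemma ergodic_measure_criterion : invariant_measure Pt rho ->
  (forall G, measurable G ->
    (forall t, (0 < t)%R -> {ae rho, forall x, Pt t x G = (\1_G x)%:E}) ->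
    rho G = 0 \/ rho G = 1) ->
  ergodic_measure Pt rho.
Proof.
move=> inv H; split => // Q HQ A mA invA.
have [G mG AG] := invariant_event_state HQ mA invA.
have mev := @measurable_preimage_coord _ X T.
have QAG : Q A = rho G.
  exact: etrans (setY_null_eq mA (mev 0%R _ mG) AG) (canonical_coord0 HQ 0%R mG).
suff [rG|rG] : rho G = 0 \/ rho G = 1.
  by left; exact: etrans QAG rG.
  by right; exact: etrans QAG rG.
apply: H => // t t0; apply: (state_event_harmonic HQ) => //.
have mSA : measurable (path_shift t @^-1` A : set (path_space X T)).
  exact: measurable_preimage_path_shift.
(* The events [w 0 \in G] and [w t \in G] are compared through [A] and the shifted [A]; the last of
   the three sets is the shift of the first, hence null by stationarity. *)
pose N : set (path_space X T) := (A `+` (fun w : T -> X => w 0%R) @^-1` G) `|`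
  (A `+` (path_shift t @^-1` A)) `|`
  (path_shift t @^-1` A `+` (fun w : T -> X => w t) @^-1` G).
have mN : measurable N.
  by apply: measurableU; [apply: measurableU|]; apply: measurable_setY => //; exact: mev.
have N0 : Q N = 0.
  have m1 := measurable_setY mA (mev 0%R _ mG); have m2 := measurable_setY mA mSA.
  have m3 := measurable_setY mSA (mev t _ mG).
  apply: null_set_setU => //; first exact: measurableU.
    by apply: null_set_setU => //; apply: invA; exact: ltW.
  rewrite -AG -[RHS](canonical_stationary HQ t m1); congr (Q _).
  by apply/funext => w; rewrite /preimage /setY /= /path_shift addr0.
apply: subset_measure0 N0 => //; first by apply: measurable_setY; exact: mev.
move=> w GG; rewrite /N /setY /=.
move: GG => /= [[/= G0 nGt]|[/= Gt nG0]];
  have [Aw|Aw] := pselect (A w); have [Sw|Sw] := pselect (A (path_shift t w)); tauto.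
Qed.

End ergodicity_criterion.

(** * Zero-one law for the periodic measure and the discrete semigroup *)

Section discrete_ergodicity.
Set Implicit Arguments.
Unset Strict Implicit.
Local Open Scope ereal_scope.
Context {R : realType} {d d' : measure_display}.
Context {Omega : measurableType d} {X : measurableType d'}.
Variable P : probability Omega R.
Variables (theta : R -> Omega -> Omega) (tau : R).
Variable rho : R -> probability X R.
Variables (Phi : R -> Omega -> X -> X) (Y : R -> Omega -> X).

Lemma measurable_flow_time (t : R) : metric_flow P theta ->
  measurable_fun [set: Omega] (theta t).
Proof.
move=> flow; exact: (measurableT_comp (flow_measurable flow) (pair1_measurable t)).
Qed.

Lemma measurable_rpp_time (s : R) : random_periodic_path P theta Phi tau Y ->
  measurable_fun [set: Omega] (Y s).
Proof.
by move=> rpp; exact: (measurableT_comp (rpp_measurable rpp) (pair1_measurable s)).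
Qed.

(** [Y s w] and [Y s (theta tau w) = Y (s + tau) w] are the lattice points with [k = 0] and [k = 1],
    so almost surely both are in [G] or neither is: the event [Y s w \in G] is invariant under
    [theta tau] up to a null set. *)
Lemma lattice_zero_one (s : R) (G : set X) :
  metric_flow P theta -> random_periodic_path P theta Phi tau Y ->
  laws_of P Y rho ->
  ergodic_system P [set: nat] (fun n => iter n (theta tau)) ->
  measurable G ->
  {ae P, forall w, lattice_path Y tau s w `&` G = set0 \/
                   lattice_path Y tau s w `<=` G} ->
  rho s G = 0 \/ rho s G = 1.
Proof.
move=> flow rpp law erg mG lattice.
have mY := measurable_rpp_time s rpp.
have mth := measurable_flow_time tau flow.
pose A : set Omega := Y s @^-1` G.
have mA : measurable A by rewrite -[X in measurable X]setTI; exact: mY.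
have mit n : measurable (iter n (theta tau) @^-1` A).
  elim: n => [//|n IH].
  rewrite (_ : _ @^-1` A = theta tau @^-1` (iter n (theta tau) @^-1` A)).
    by rewrite -[X in measurable X]setTI; exact: mth.
  by apply/funext => w; rewrite /preimage/= -iterSr.
have step : P (A `+` theta tau @^-1` A) = 0.
  apply: measure_negligible; first exact: measurable_setY (mit 1%N).
  apply: negligibleS (negligibleU lattice (rpp_eq rpp)) => w Aw.
  apply: contrapT => /not_orP[/contrapT lat /contrapT[_ per]].
  have Y0 : lattice_path Y tau s w (Y s w).
    by exists (0%R : int) => //; rewrite mul0r addr0.
  have Y1 : lattice_path Y tau s w (Y s (theta tau w)).
    by exists (1%R : int) => //; rewrite mul1r per.
  case: lat => lat.
    have nG x : lattice_path Y tau s w x -> ~ G x.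
      by move=> lx Gx; have : set0 x by rewrite -lat; split.
    by case: Aw => -[/= /nG]; exact.
  by case: Aw => -[_ /=]; apply; exact: lat.
rewrite law// -/A; apply: erg => // n _.
(* Invariance under all iterates follows from one step, since [theta tau] preserves [P] and so pulls
   the null set of the [n]-th iterate back to a null set. *)
elim: n => [|n IH]; first by rewrite /= preimage_id setYK measure0.
pose N := (A `+` theta tau @^-1` A) `|`
  theta tau @^-1` (A `+` (iter n (theta tau) @^-1` A)).
have mN2 : measurable (theta tau @^-1` (A `+` (iter n (theta tau) @^-1` A))).
  by rewrite -[X in measurable X]setTI; apply: mth => //; exact: measurable_setY.
have N0 : P N = 0.
  apply: null_set_setU => //; first exact: measurable_setY (mit 1%N).
  exact: etrans (flow_preserving flow tau (measurable_setY mA (mit n))) IH.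
have mN : measurable N by apply: measurableU => //; exact: measurable_setY (mit 1%N).
apply: subset_measure0 N0 => //; first exact: measurable_setY.
move=> w; rewrite /N /setY /setU /setD /preimage /= -iterS iterSr => H.
have [Aw|Aw] := pselect (A w); have [Sw|Sw] := pselect (A (theta tau w)); tauto.
Qed.

Variable Pt : R -> R.-pker X ~> X.

Lemma periodic_measure_nat (s : R) (n : nat) (G : set X) :
  periodic_measure Pt tau rho -> measurable G ->
  rho (s + n%:R * tau)%R G = rho s G.
Proof.
move=> per mG; elim: n => [|n IH]; first by rewrite mul0r addr0.
by rewrite -natr1 mulrDl mul1r addrA (per _ _ mG).2.
Qed.

Lemma harmonic_invariant_sets (s : R) (G : set X) : measurable G ->
  {ae rho s, forall x, Pt tau x G = (\1_G x)%:E} ->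
  invariant_sets Pt tau (rho s) G.
Proof.
move=> mG H; split => //; apply: filterS H => x Hx.
by rewrite /semigroup_op integral_indic// setIT.
Qed.

Lemma discrete_ergodic_measure (s : R) :
  (0 < tau)%R -> periodic_measure Pt tau rho ->
  (forall G, invariant_sets Pt tau (rho s) G -> rho s G = 0 \/ rho s G = 1) ->
  ergodic_measure (discrete_semigroup Pt tau) (rho s).
Proof.
move=> tau0 per H; apply: ergodic_measure_criterion.
  move=> [n|//] _ G mG.
  rewrite /semigroup_dual /discrete_semigroup -pmulrn -(periodic_measure_nat s n per mG).
  by apply: (per _ _ mG).1; rewrite mulr_ge0 ?ler0n ?(ltW tau0).
(* Time 1 of the discrete semigroup is time [tau] of [Pt], the time in [invariant_sets]. *)
move=> G mG /(_ 1%R ltr01); rewrite /discrete_semigroup mul1r => harm.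
by apply: H; exact: harmonic_invariant_sets.
Qed.

End discrete_ergodicity.

(** * Integrals of periodic functions over one period *)

Section periodic_integral.
Set Implicit Arguments.
Unset Strict Implicit.
Local Open Scope ereal_scope.
Context {R : realType}.
Local Notation mu := (@lebesgue_measure R).

Lemma measurable_addl (t : R) : measurable_fun [set: R] (fun s : R => t + s)%R.
Proof. exact: measurable_funD. Qed.

Lemma lebesgue_measure_addl (t : R) (A : set R) : measurable A ->
  pushforward mu (fun s : measurableTypeR R => (t + s)%R : measurableTypeR R) A = mu A.
Proof.
move=> mA; apply/esym/lebesgue_measure_unique => //=.
  exact: measurable_addl.
move=> ? _ [[a b]] _ <-.
rewrite /pushforward.
rewrite (_ : _ @^-1` _ = `](a - t)%R, (b - t)%R]%classic); last first.
  by apply/seteqP; split=> x /=; rewrite !in_itv/= ltrBlDl lerBrDl.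
rewrite !lebesgue_measure_itv/= !lte_fin ltrD2r.
by case: ifPn => // _; rewrite -!EFinB; congr (_%:E); lra.
Qed.

Lemma ge0_integral_addl (t : R) (D : set R) (h : R -> \bar R) :
  measurable D -> measurable_fun [set: R] h -> (forall s, 0 <= h s) ->
  \int[mu]_(s in (fun s => t + s)%R @^-1` D) h (t + s)%R = \int[mu]_(s in D) h s.
Proof.
move=> mD mh h0.
rewrite -(@ge0_integral_pushforward _ _ _ _ _
  (fun s : measurableTypeR R => (t + s)%R : measurableTypeR R)
  (measurable_addl t) mu D h mD)//.
- apply: eq_measure_integral; first exact: measurable_addl.
  by move=> ? A mA _; exact: lebesgue_measure_addl.
- exact: measurable_funTS.
Qed.

Variable tau : R.
Hypothesis tau_gt0 : (0 < tau)%R.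

(** Removing [k] whole periods from [t] leaves [r] in [[0, tau)]. The part of [[r, r + tau]] beyond
    [tau] is then moved back by one period onto [[0, r]]. *)
Lemma ge0_integral_periodic (h : R -> \bar R) (t : R) :
  measurable_fun [set: R] h -> (forall s, 0 <= h s) ->
  (forall s, h (s + tau)%R = h s) -> (0 <= t)%R ->
  \int[mu]_(s in `[0%R, tau]) h (t + s)%R = \int[mu]_(s in `[0%R, tau]) h s.
Proof.
move=> mh h0 hper t0.
have hn n s : h (s + n%:R * tau)%R = h s.
  elim: n => [|n IH]; first by rewrite mul0r addr0.
  by rewrite -natr1 mulrDl mul1r addrA hper.
pose k := Num.truncn (t / tau).
have /andP[kt tk] : (k%:R <= t / tau < k.+1%:R)%R.
  by apply: truncn_itv; rewrite divr_ge0// ltW.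
pose r := (t - k%:R * tau)%R.
have r0 : (0 <= r)%R by rewrite subr_ge0 -ler_pdivlMr.
have rtau : (r < tau)%R.
  by rewrite ltrBlDl -[X in (_ + X)%R]mul1r -mulrDl natr1 -ltr_pdivrMr.
have -> : \int[mu]_(s in `[0%R, tau]) h (t + s)%R =
    \int[mu]_(s in `[0%R, tau]) h (r + s)%R.
  apply: eq_integral => s _; rewrite -[RHS](hn k); congr h.
  by rewrite /r addrAC subrK.
have itvE (a b c : R) : `[(a - c)%R, (b - c)%R]%classic =
    (fun s => c + s)%R @^-1` `[a, b]%classic.
  by apply/seteqP; split=> x /=; rewrite !in_itv/= lerBlDl lerBrDl.
have split (a b c : R) : (a <= b)%R -> (b <= c)%R ->
    \int[mu]_(s in `[a, c]) h s =
    \int[mu]_(s in `[a, b]) h s + \int[mu]_(s in `[b, c]) h s.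
  move=> ab bc.
  (* The shared endpoint [b] is a null set; dropping it from the second interval makes the union
     disjoint. *)
  rewrite -[X in _ = _ + X](@integral_itv_obnd_cbnd _ b (BRight c)); last first.
    exact: measurable_funTS.
  rewrite -ge0_integral_setU//=.
  - by rewrite -itv_bndbnd_setU ?bnd_simp.
  - exact: measurable_funTS.
  - rewrite disj_set2E; apply/eqP; rewrite -subset0 => x [] /=.
    by rewrite !in_itv/= => /andP[_ xb] /andP[bx _]; move: xb; rewrite leNgt bx.
have shift (a b c : R) : \int[mu]_(s in `[a, b]) h s =
    \int[mu]_(s in `[(a - c)%R, (b - c)%R]) h (c + s)%R.
  by rewrite itvE ge0_integral_addl.
transitivity (\int[mu]_(s in `[r, (r + tau)%R]) h s).
  by rewrite (shift r (r + tau)%R r) subrr addrAC subrr add0r.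
rewrite (split r tau (r + tau)%R) ?(ltW rtau) ?lerDr//.
rewrite (shift tau (r + tau)%R tau) subrr addrK.
under [X in _ + X]eq_integral do rewrite addrC hper.
by rewrite addeC -split// ltW.
Qed.

(* A [tau]-periodic function with values in [{0, 1}] that is almost
   everywhere invariant under every translation has autocorrelation
   [\int f(s) f(s + t) ds = \int f] for all [t]; averaging over [t] gives
   [(\int f)^2 = tau * \int f]. *)
Lemma translation_invariant_zero_one (f : R -> R) :
  measurable_fun [set: R] f -> (forall s, 0 <= f s <= 1)%R ->
  (forall s, f (s + tau) = f s)%R ->
  (forall t, (0 < t)%R ->
    {ae mu, forall s, s \in `[0%R, tau] -> f (s + t)%R = f s}) ->
  {ae mu, forall s, s \in `[0%R, tau] -> f s = 0%R \/ f s = 1%R} ->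
  \int[mu]_(s in `[0%R, tau]) (f s)%:E = 0 \/
  \int[mu]_(s in `[0%R, tau]) (f s)%:E = tau%:E.
Proof.
move=> mf f01 fper finv f_bool.
have f0 s : (0 <= f s)%R by have /andP[] := f01 s.
pose D : set R := `[0%R, tau]%classic.
have mD : measurable D by exact: measurable_itv.
have mfE : measurable_fun [set: R] (EFin \o f) by exact/measurable_EFinP.
set I := \int[mu]_(s in _) _.
have I0 : 0 <= I by apply: integral_ge0 => s _; rewrite lee_fin.
have muD : mu D = tau%:E.
  by rewrite /D lebesgue_measure_itv/= lte_fin tau_gt0 -EFinB subr0.
have Ifin : I \is a fin_num.
  rewrite ge0_fin_numE//; apply: (@le_lt_trans _ _ (\int[mu]_(s in D) 1)).
    apply: ge0_le_integral => //.
    - by move=> s _; rewrite lee_fin.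
    - exact: measurable_funTS.
    - by move=> s _; rewrite lee_fin; have /andP[] := f01 s.
  by rewrite integral_cst// mul1e; apply: le_lt_trans (ltry tau); rewrite -muD.
(* [p.1] is the translation and [p.2] the position; the indicators confine both to one period, so
   that Tonelli's theorem applies on the whole plane. Integrating over positions first gives
   [tau * I], over translations first [I * I]. *)
pose F (p : R * R) : \bar R := (\1_D p.1 * \1_D p.2 * (f p.2 * f (p.2 + p.1)%R))%:E.
have F0 p : 0 <= F p.
  by rewrite lee_fin !mulr_ge0.
have mF : measurable_fun [set: R * R] F.
  apply/measurable_EFinP; apply: measurable_funM; apply: measurable_funM.
  - by apply: measurableT_comp => //; exact: measurable_indic.
  - by apply: measurableT_comp => //; exact: measurable_indic.
  - exact: measurableT_comp.
  - by apply: measurableT_comp => //; exact: measurable_funD.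
have := @fubini_tonelli _ _ _ _ R mu mu F mF F0.
have patch (h : R -> \bar R) : (forall s, 0 <= h s) ->
    \int[mu]_s ((\1_D s)%:E * h s) = \int[mu]_(s in D) h s.
  move=> h0; rewrite [RHS]integral_mkcond; apply: eq_integral => s _.
  by rewrite /restrict indicE; case: ifPn; rewrite ?mul1e ?mul0e.
have corr t : D t -> \int[mu]_s F (t, s) = I.
  move=> Dt; transitivity (\int[mu]_s ((\1_D s)%:E * (f s * f (s + t)%R)%:E)).
    by apply: eq_integral => s _; rewrite /F/= indicE mem_set// mul1r EFinM.
  rewrite patch; last by move=> s; rewrite lee_fin mulr_ge0.
  apply: ae_eq_integral => //.
  - apply/measurable_EFinP/measurable_funTS/measurable_funM => //.
    by apply: measurableT_comp => //; exact: measurable_funD.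
  - exact: measurable_funTS.
  (* The assumption concerns positive translations; [t = 0] is trivial. *)
  have finvt : {ae mu, forall s, s \in `[0%R, tau] -> f (s + t)%R = f s}.
    move: Dt; rewrite /D /= in_itv/= => /andP[t0 _].
    move: t0; rewrite le_eqVlt => /orP[/eqP <-|]; last exact: finv.
    by apply: aeW => s _; rewrite addr0.
  apply: negligibleS (negligibleU finvt f_bool) => s; apply: contraPP.
  move=> /not_orP[/contrapT e1 /contrapT e2]; apply => Ds /=.
  (* Here [f s * f (s + t) = f s * f s = f s], because [f s] is 0 or 1. *)
  by rewrite e1//; have [->|->] := e2 Ds; rewrite ?mulr0 ?mulr1.
rewrite [X in X = _ -> _](_ : _ = tau%:E * I); last first.
  transitivity (\int[mu]_(t in D) I).
    rewrite [RHS]integral_mkcond; apply: eq_integral => t _.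
    rewrite /fubini_F /restrict; case: ifPn => [/set_mem|tD]; first exact: corr.
    by rewrite integral0_eq// => s _; rewrite /F/= indicE (negbTE tD)/= !mul0r.
  rewrite integral_cst//.
  exact: etrans (congr1 (fun z => I * z) muD) (muleC _ _).
rewrite [X in _ = X -> _](_ : _ = I * I); last first.
  transitivity (\int[mu]_(s in D) ((f s)%:E * I)).
    rewrite [RHS]integral_mkcond; apply: eq_integral => s _.
    rewrite /fubini_G /restrict; case: ifPn => [/set_mem sD|sD]; last first.
      by rewrite integral0_eq// => t _; rewrite /F/= !indicE (negbTE sD)/= mulr0 !mul0r.
    transitivity (\int[mu]_t ((\1_D t)%:E * ((f s)%:E * (f (s + t)%R)%:E))).
      apply: eq_integral => t _; rewrite /F/= [in X in (_ * X * _)%R]indicE.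
      by rewrite mem_set// mulr1 -!EFinM.
    rewrite patch; last by move=> t; rewrite mule_ge0// lee_fin.
    rewrite ge0_integralZl//.
    - congr (_ * _); apply: (ge0_integral_periodic (h := EFin \o f)) => //.
      + by move=> u; rewrite /= fper.
      + by move: sD; rewrite /D/= in_itv/= => /andP[].
    - by apply/measurable_funTS/(measurableT_comp mfE); exact: measurable_addl.
    - by move=> t _; rewrite lee_fin.
    - by rewrite lee_fin.
  rewrite ge0_integralZr//.
  - exact: measurable_funTS.
  - by move=> s _; rewrite lee_fin.
move: I0; rewrite -(fineK Ifin) -!EFinM lee_fin => I0 [] /eqP.
rewrite -subr_eq0 -mulrBl mulf_eq0 => /orP[|/eqP ->]; last by left.
by rewrite subr_eq0 => /eqP <-; right.
Qed.

End periodic_integral.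

(** * Invariance and ergodicity of the average measure *)

Section average_ergodicity.
Set Implicit Arguments.
Unset Strict Implicit.
Local Open Scope ereal_scope.
Context {R : realType} {d d' : measure_display}.
Context {Omega : measurableType d} {X : measurableType d'}.
Variable P : probability Omega R.
Variables (theta : R -> Omega -> Omega) (tau : R).
Variables (Pt : R -> R.-pker X ~> X) (rho : R -> probability X R).
Variables (Phi : R -> Omega -> X -> X) (Y : R -> Omega -> X).
Variable rhobar : probability X R.
Hypothesis tau_gt0 : (0 < tau)%R.
Hypothesis rpp : random_periodic_path P theta Phi tau Y.
Hypothesis law : laws_of P Y rho.
Hypothesis per : periodic_measure Pt tau rho.
Hypothesis avg : period_average tau rho rhobar.
Local Notation mu := (@lebesgue_measure R).

(** [rho s G] is the [P]-measure of the section at [s] of a jointly measurable set. *)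
Lemma measurable_law (G : set X) : measurable G ->
  measurable_fun [set: R] (fun s => rho s G).
Proof.
move=> mG; pose W : set (R * Omega) := (fun p => Y p.1 p.2) @^-1` G.
have mW : measurable W.
  by rewrite -[X in measurable X]setTI; exact: (rpp_measurable rpp).
rewrite (_ : (fun s => rho s G) = P \o xsection W).
  exact: measurable_fun_xsection.
apply/funext => s /=; rewrite law//; congr (P _).
by apply/seteqP; split=> w; rewrite /xsection/= inE.
Qed.

Lemma integral_period_average (H : X -> \bar R) :
  measurable_fun setT H -> (forall x, 0 <= H x) ->
  \int[mu]_(s in `[0%R, tau]) \int[rho s]_x H x = tau%:E * \int[rhobar]_x H x.
Proof.
move=> mH H0.
have cstE (c : \bar R) : \int[mu]_(s in `[0%R, tau]) c = tau%:E * c.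
  have muD : mu `[0%R, tau]%classic = tau%:E.
    by rewrite lebesgue_measure_itv/= lte_fin tau_gt0 -EFinB subr0.
  rewrite integral_cst//.
  exact: etrans (congr1 (fun z => c * z) muD) (muleC _ _).
rewrite -cstE.
apply: (@ge0_integral_mixture_eq _ _ _ _ _ mu `[0%R, tau]%classic
  (fun s => rho s) (fun=> rhobar)) => //.
- exact: measurable_law.
- move=> G mG /=; rewrite cstE avg// muleA -EFinM divff ?mul1e//.
  by rewrite gt_eqF.
Qed.

(** Averaging [P_t^* rho_s = rho_(s + t)] over a period gives the result, since translating a
    periodic function by [t] does not change its integral over a period. *)
Lemma period_average_invariant : invariant_measure Pt rhobar.
Proof.
move=> t t0 G mG; rewrite /semigroup_dual.
have tauE : tau%:E * \int[rhobar]_x Pt t x G = tau%:E * rhobar G.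
  rewrite -integral_period_average//; last exact: measurable_kernel.
  rewrite [RHS](_ : _ = \int[mu]_(s in `[0%R, tau]) rho s G); last first.
    by rewrite avg// muleA -EFinM divff ?mul1e// gt_eqF.
  rewrite -(ge0_integral_periodic tau_gt0 (measurable_law mG) _ _ t0)//; last first.
    by move=> s; exact: (per s mG).2.
  by apply: eq_integral => s _; rewrite addrC -(per s mG).1.
have := congr1 (fun z => (tau^-1)%:E * z) tauE.
by rewrite !muleA -EFinM mulVf ?mul1e// gt_eqF.
Qed.

Lemma period_average_null (N : set X) : measurable N -> rhobar N = 0 ->
  {ae mu, forall s, s \in `[0%R, tau] -> rho s N = 0}.
Proof.
move=> mN N0.
have I0 : \int[mu]_(s in `[0%R, tau]) `|rho s N| = 0.
  under eq_integral do rewrite gee0_abs//.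
  have := avg mN; rewrite N0 => /(congr1 (fun z => tau%:E * z)).
  by rewrite mule0 muleA -EFinM divff ?mul1e ?gt_eqF.
have mD : measurable (`[0%R, tau]%classic : set (measurableTypeR R)) by [].
exact: (ae_eq_integral_abs mu mD (measurable_funTS (measurable_law mN))).1 I0.
Qed.

(** If [P_t 1_G = 1_G] holds [rho_s]-almost everywhere, then integrating it against [rho_s] gives
    [rho_(s + t) G = rho_s G]; for [t = tau] it makes [G] an invariant set of [rho_s], so that
    [zero_one] applies. *)
Lemma period_average_ergodic :
  (forall s G, invariant_sets Pt tau (rho s) G -> rho s G = 0 \/ rho s G = 1) ->
  ergodic_measure Pt rhobar.
Proof.
move=> zero_one; apply: ergodic_measure_criterion.
  exact: period_average_invariant.
move=> G mG harm.
(* A [rhobar]-null set is [rho_s]-null for almost every [s] in the period. The exceptional [s]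
   depend on [t], which is why translation invariance of [f] is obtained almost everywhere for each
   [t] separately. *)
have aeharm t : (0 < t)%R -> {ae mu, forall s, s \in `[0%R, tau] ->
    {ae rho s, forall x, Pt t x G = (\1_G x)%:E}}.
  move=> t0; pose N := [set x | Pt t x G != (\1_G x)%:E].
  have mN : measurable N.
    rewrite -[N]setTI; apply: measurable_neqe => //.
      exact: measurable_kernel.
    by apply/measurable_EFinP; exact: measurable_indic.
  have N0 : rhobar N = 0.
    apply: measure_negligible => //; apply: negligibleS (harm t t0) => x /=.
    by move=> /eqP.
  apply: negligibleS (period_average_null mN N0) => s; apply: contraPP.
  move=> /contrapT NN; apply => ss; exists N; split => //; first exact: NN.
  by move=> x /= /eqP.
pose f s := fine (rho s G).
have fE s : (f s)%:E = rho s G by rewrite fineK// fin_num_measure.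
have := @translation_invariant_zero_one R tau tau_gt0 f.
under eq_integral do rewrite fE.
have avgG := avg mG.
case.
- apply/measurable_EFinP; rewrite (_ : _ \o _ = fun s => rho s G).
    exact: measurable_law.
  by apply/funext => s /=.
- by move=> s; rewrite -!lee_fin fE measure_ge0 probability_le1.
- by move=> s; rewrite /f (per s mG).2.
- move=> t t0; apply: negligibleS (aeharm t t0) => s; apply: contraPP.
  move=> /contrapT hs; apply => ss; congr fine.
  rewrite -((per s mG).1 t (ltW t0)) /semigroup_dual.
  rewrite -[in RHS](setIT G) -integral_indic//.
  apply: ae_eq_integral => //.
  + exact: measurable_kernel.
  + by apply/measurable_EFinP; exact: measurable_indic.
  + by apply: filterS (hs ss) => x.
- apply: negligibleS (aeharm tau tau_gt0) => s; apply: contraPP.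
  move=> /contrapT hs; apply => ss; rewrite /f.
  by have [->|->] := zero_one s G (harmonic_invariant_sets mG (hs ss)); [left|right].
- by move=> I0; left; rewrite avgG I0 mule0.
- by move=> I0; right; rewrite avgG I0 -EFinM mulVf// gt_eqF.
Qed.

End average_ergodicity.

(** * PS-ergodicity and ergodicity of the average *)

Theorem theorem3p5 (R : realType) (d : measure_display)
    (Omega : measurableType d) (P : probability Omega R)
    (theta : R -> Omega -> Omega) (F : R -> R -> set (set Omega))
    (X : ptopologicalType)
    (Phi : R -> Omega -> borel X -> borel X)
    (Pt : R -> R.-pker (borel X) ~> (borel X))
    (tau : R) (Y : R -> Omega -> borel X)
    (rho : R -> probability (borel X) R) (rhobar : probability (borel X) R)
    (X_polish : polish_space R X)
    (theta_flow : metric_flow P theta)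
    (F_filtration : filtration theta F)
    (Phi_cocycle : cocycle P theta F Phi)
    (Phi_markovian : markovian P Phi Pt)
    (tau_gt0 : 0 < tau)
    (Y_periodic : random_periodic_path P theta Phi tau Y)
    (Y_adapted : adapted F Y)
    (rho_law : laws_of P Y rho)
    (rho_periodic : periodic_measure Pt tau rho)
    (rhobar_average : period_average tau rho rhobar)
    (lattice_cond : forall (s : R) (G : set (borel X)),
       invariant_sets Pt tau (rho s) G ->
       {ae P, forall w, lattice_path Y tau s w `&` G = set0 \/
                        lattice_path Y tau s w `<=` G})
    (theta_ergodic :
       ergodic_system P [set: nat] (fun n => iter n (theta tau))) :
  PS_ergodic Pt tau rho /\ ergodic_measure Pt rhobar.
Proof.
(* This zero-one law at every real [s] feeds both conclusions: directly for [rho_s], and through the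
   values of [s |-> rho_s G] for [rhobar]. *)
have zero_one s G : invariant_sets Pt tau (rho s) G ->
    rho s G = 0%E \/ rho s G = 1%E.
  move=> Ginv.
  exact: (lattice_zero_one theta_flow Y_periodic rho_law theta_ergodic
    Ginv.1 (lattice_cond s G Ginv)).
split; last first.
  exact: (period_average_ergodic tau_gt0 Y_periodic rho_law rho_periodic
    rhobar_average zero_one).
by move=> s _; exact: (discrete_ergodic_measure tau_gt0 rho_periodic (zero_one s)).
Qed.
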